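(* Let $(M,\mathcal D,h)$ be a sub-Riemannian geometry, let $g$ be a Riemannian metric on $TM$ that restricts to $h$ on $\mathcal D$, and let $\mathcal D^\perp$ be the $g$-orthogonal complement of $\mathcal D$ in $TM$. Then there is a unique metric connection $\nabla$ on $TM$ (i.e. a linear connection with $\nabla g=0$) such that both $\mathcal D$ and $\mathcal D^\perp$ are preserved by $\nabla$ and the components of its torsion $T$ satisfy: (1) $T^{\mathcal D}_{\mathcal D\mathcal D}=0$; (2) $T^{\mathcal D^\perp}_{\mathcal D^\perp\mathcal D^\perp}=0$; (3) $T^{\mathcal D^\perp}_{\mathcal D\mathcal D^\perp}$ is symmetric with respect to $g_{|\mathcal D^\perp}$; (4) $T^{\mathcal D}_{\mathcal D\mathcal D^\perp}$ is symmetric with respect to $g_{|\mathcal D}$.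
   Context: All manifolds are smooth, connected and finite dimensional, and all tensors and maps are smooth. A sub-Riemannian geometry $(M,\mathcal D,h)$ is a smooth manifold $M$ with a bracket generating distribution $\mathcal D\subset TM$ of constant rank and a positive definite metric $h$ on $\mathcal D$. A connection preserves a subbundle $E\subset TM$ if $\nabla_XY$ is a section of $E$ for every vector field $X$ and every section $Y$ of $E$. The torsion is $T(X,Y)=\nabla_XY-\nabla_YX-[X,Y]$. For $A,B,C\in\{\mathcal D,\mathcal D^\perp\}$, $T^A_{BC}:B\times C\to A$ denotes the restriction of $T$ to arguments in $B$ and $C$, followed by $g$-orthogonal projection to $A$. ''$T^{\mathcal D^\perp}_{\mathcal D\mathcal D^\perp}$ is symmetric with respect to $g_{|\mathcal D^\perp}$'' means $g(T(Z,X),Y)=g(X,T(Z,Y))$ for all $Z\in\mathcal D$ and $X,Y\in\mathcal D^\perp$. ''$T^{\mathcal D}_{\mathcal D\mathcal D^\perp}$ is symmetric with respect to $g_{|\mathcal D}$'' means $g(T(X,Z),Y)=g(X,T(Y,Z))$ for all $X,Y\in\mathcal D$ and $Z\in\mathcal D^\perp$. *)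

(* Defs.v *)
From HB Require Import structures.
From mathcomp Require Import all_boot all_order all_algebra.
From mathcomp Require Import all_classical all_reals all_analysis.

Set Implicit Arguments.
Unset Strict Implicit.
Unset Printing Implicit Defensive.

Import Order.TTheory GRing.Theory Num.Theory.
From mathcomp Require Import ring.
Import numFieldNormedType.Exports.

Local Open Scope classical_set_scope.
Local Open Scope ring_scope.

Section SmoothRn.
Context {R : realType} {n : nat}.
Implicit Types (U : set 'rV[R]_n) (f g : 'rV[R]_n -> R).

(* Class C^k on the open set U; k = infinity is Csmooth. *)
Fixpoint Ck (k : nat) U f : Prop :=
  {in U, continuous f} /\
  if k is k'.+1 then
    forall i : 'I_n, (forall x, U x -> derivable f x (delta_mx 0 i)) /\
                     Ck k' U ('D_(delta_mx 0 i) f)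
  else True.

Definition Csmooth U f : Prop := forall k, Ck k U f.

Lemma Ck_cont k U f : Ck k U f -> {in U, continuous f}.
Proof. by case: k => [|k] []. Qed.

Lemma Ck_pred k U f : Ck k.+1 U f -> Ck k U f.
Proof.
elim: k f => [|k IH] f [fc fD]; first by split.
split=> // i; have [fi fDi] := fD i; split=> //; exact: IH.
Qed.

Lemma near_of_open U f g x : open U -> (forall y, U y -> f y = g y) ->
  U x -> {near x, f =1 g}.
Proof.
move=> oU fg Ux; have UU : \forall y \near x, U y by exact: open_nbhs_nbhs.
by apply: filterS UU => y /fg.
Qed.

Lemma Ck_eq k U f g : open U -> (forall x, U x -> f x = g x) ->
  Ck k U f -> Ck k U g.
Proof.
move=> oU; elim: k f g => [|k IH] f g fg [fc fD].
all: have gc : {in U, continuous g} by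
  move=> x xU; have Ux : U x by [rewrite inE in xU];
  rewrite /continuous_at -(fg _ Ux);
  exact: cvg_trans (near_eq_cvg (near_of_open oU fg Ux)) (fc x xU).
all: split=> //.
move=> i; have [fi fDi] := fD i; split=> [x Ux|].
  by apply: near_eq_derivable (fi x Ux); exact: (near_of_open oU fg Ux).
apply: IH fDi => x Ux; apply: near_eq_derive; exact: (near_of_open oU fg Ux).
Qed.

Lemma Ck_cst k U (c : R) : Ck k U (cst c).
Proof.
have cc (c' : R) : {in U, continuous (cst c' : 'rV[R]_n -> R)}.
  by move=> x _; exact: cst_continuous.
elim: k c => [|k IH] c; split=> //.
move=> i; split=> [x _|]; first exact: derivable_cst.
have -> : 'D_(delta_mx 0 i) (cst c : 'rV[R]_n -> R) = cst 0.
  by apply/funext => x; rewrite derive_cst.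
exact: IH.
Qed.

Lemma Ck_add k U f g : open U -> Ck k U f -> Ck k U g -> Ck k U (f + g).
Proof.
move=> oU; elim: k f g => [|k IH] f g [fc fD] [gc gD]; split=> //.
1,2: by move=> x xU; apply: continuousD; [exact: fc|exact: gc].
move=> i; have [fi fDi] := fD i; have [gi gDi] := gD i; split=> [x Ux|].
  by apply: derivableD; [exact: fi|exact: gi].
apply: Ck_eq (IH _ _ fDi gDi) => // x Ux.
by rewrite deriveD//; [exact: fi|exact: gi].
Qed.

Lemma Ck_mul k U f g : open U -> Ck k U f -> Ck k U g -> Ck k U (f * g).
Proof.
move=> oU; elim: k f g => [|k IH] f g fk gk.
  move: fk gk => [fc fD] [gc gD].
  by split=> // x xU; apply: continuousM; [exact: fc|exact: gc].
have [fk' gk'] := (Ck_pred fk, Ck_pred gk); move: fk gk => [fc fD] [gc gD].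
split; first by move=> x xU; apply: continuousM; [exact: fc|exact: gc].
move=> i; have [fi fDi] := fD i; have [gi gDi] := gD i; split=> [x Ux|].
  by apply: derivableM; [exact: fi|exact: gi].
apply: Ck_eq (Ck_add oU (IH _ _ fk' gDi) (IH _ _ gk' fDi)) => // x Ux.
by rewrite deriveM//; [exact: fi|exact: gi].
Qed.

End SmoothRn.

(* The partial inverse [cinv] is only meaningful on the open set
   [cmap @` cdom]. *)
Record chart (R : realType) (n : nat) (M : topologicalType) := Chart {
  cdom : set M;
  cmap : M -> 'rV[R]_n;
  cinv : 'rV[R]_n -> M;
  cdom_open : open cdom;
  cimg_open : open (cmap @` cdom);
  cmapK : {in cdom, cancel cmap cinv};
  cmap_continuous : {in cdom, continuous cmap};
  cinv_continuous : {in cmap @` cdom, continuous cinv} }.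

Record manifold (R : realType) (n : nat) := Manifold {
  mspace :> topologicalType;
  atlas : set (chart R n mspace);
  mspace_hausdorff : hausdorff_space mspace;
  mspace_second_countable : @second_countable mspace;
  mspace_connected : connected [set: mspace];
  atlas_cover : forall p : mspace, exists2 c, atlas c & cdom c p;
  atlas_compat : forall c d, atlas c -> atlas d -> forall i : 'I_n,
    Csmooth (cmap c @` (cdom c `&` cdom d)) (fun x => cmap d (cinv c x) 0 i) }.

Section SmoothFunctions.
Context {R : realType} {n : nat} {M : manifold R n}.
Implicit Types (U : set M) (f g : M -> R).

Definition smooth_on U f : Prop := forall c, atlas c ->
  Csmooth (cmap c @` (U `&` cdom c)) (f \o cinv c).

Lemma chart_img_open (c : chart R n M) U :
  open U -> open (cmap c @` (U `&` cdom c)).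
Proof.
move=> oU; rewrite openE => _ [p [Up cp] <-].
have ip : (cmap c @` cdom c) (cmap c p) by exists p.
have nD : nbhs (cmap c p) (cmap c @` cdom c).
  by apply: open_nbhs_nbhs; split=> //; exact: cimg_open.
have nU : nbhs (cmap c p) (cinv c @^-1` U).
  apply: cinv_continuous; first by rewrite inE.
  by rewrite cmapK ?inE//; exact: open_nbhs_nbhs.
apply: filterS2 nD nU => _ [q cq <-] /=; rewrite cmapK ?inE// => Uq.
by exists q.
Qed.

Lemma smooth_on_cst U (a : R) : smooth_on U (cst a).
Proof. by move=> c _ k; exact: Ck_cst. Qed.

Lemma smooth_onD U f g : open U ->
  smooth_on U f -> smooth_on U g -> smooth_on U (f + g).
Proof.
move=> oU sf sg c ac k; apply: Ck_add (sf c ac k) (sg c ac k).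
exact: chart_img_open.
Qed.

Lemma smooth_onM U f g : open U ->
  smooth_on U f -> smooth_on U g -> smooth_on U (f * g).
Proof.
move=> oU sf sg c ac k; apply: Ck_mul (sf c ac k) (sg c ac k).
exact: chart_img_open.
Qed.

Lemma smooth_onZ U (a : R) f : open U -> smooth_on U f -> smooth_on U (a *: f).
Proof. by move=> oU; exact: (smooth_onM oU (smooth_on_cst U a)). Qed.

Lemma smooth_onB U f g : open U ->
  smooth_on U f -> smooth_on U g -> smooth_on U (f - g).
Proof.
move=> oU sf sg; rewrite -scaleN1r; apply: smooth_onD => //.
exact: smooth_onZ.
Qed.

Definition smoothb : {pred M -> R} := fun f => `[< smooth_on setT f >].

Lemma smoothbP f : reflect (smooth_on setT f) (f \in smoothb).
Proof. exact: asboolP. Qed.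

Lemma smoothb_subring : subring_closed smoothb.
Proof.
split=> [|f g /smoothbP sf /smoothbP sg|f g /smoothbP sf /smoothbP sg].
all: apply/smoothbP.
- exact: smooth_on_cst.
- exact: smooth_onB openT _ _.
- exact: smooth_onM openT _ _.
Qed.

Lemma smoothb_submod : subsemimod_closed smoothb.
Proof.
split=> [|a f /smoothbP sf]; last by apply/smoothbP; exact: smooth_onZ openT _.
split=> [|f g /smoothbP sf /smoothbP sg]; apply/smoothbP.
  exact: smooth_on_cst.
exact: smooth_onD openT _ _.
Qed.

End SmoothFunctions.

Record smoothfun (R : realType) (n : nat) (M : manifold R n) := SmoothFun {
  sf_fun :> M -> R;
  sf_smooth : sf_fun \in smoothb }.
Arguments SmoothFun {R n M}.

Section SmoothfunRing.
Context {R : realType} {n : nat} {M : manifold R n}.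
HB.instance Definition _ := [isSub of smoothfun M for @sf_fun R n M].
HB.instance Definition _ := [Choice of smoothfun M by <:].
HB.instance Definition _ :=
  GRing.SubChoice_isSubComPzRing.Build (M -> R) smoothb (smoothfun M)
    smoothb_subring.
HB.instance Definition _ :=
  GRing.SubZmodule_isSubLmodule.Build R (M -> R) smoothb (smoothfun M)
    smoothb_submod.
End SmoothfunRing.

(* T_pM as the derivations at p of C^oo(M), inside the R-vector space of all
   maps C^oo(M) -> R. *)
Definition tangent (R : realType) (n : nat) (M : manifold R n) (p : M) :
    set (smoothfun M -> R) :=
  [set v | (forall (a : R) (f g : smoothfun M), v (a *: f + g) = a * v f + v g) /\
           (forall f g : smoothfun M, v (f * g) = f p * v g + g p * v f)].

(* U is meant to be open; the values of X outside U are irrelevant.  Testing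
   on globally defined f suffices, by bump functions. *)
Definition smooth_vfield_on (R : realType) (n : nat) (M : manifold R n)
    (U : set M) (X : M -> smoothfun M -> R) : Prop :=
  (forall p, U p -> tangent p (X p)) /\
  (forall f, smooth_on U (fun p => X p f)).

Section VectorFields.
Context {R : realType} {n : nat} {M : manifold R n}.

Definition vfieldb : {pred M -> smoothfun M -> R} :=
  fun X => `[< smooth_vfield_on setT X >].

Lemma vfieldbP X : reflect (smooth_vfield_on setT X) (X \in vfieldb).
Proof. exact: asboolP. Qed.

Lemma tangent_comb (p : M) (a b : R) v w :
  tangent p v -> tangent p w -> tangent p (fun f => a * v f + b * w f).
Proof.
move=> [vl vM] [wl wM]; split=> [c f g|f g].
  by rewrite vl wl !mulrDr !mulrA (mulrC a c) (mulrC b c) addrACA.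
by rewrite vM wM; ring.
Qed.

Lemma vfieldb_zmod : zmod_closed vfieldb.
Proof.
split=> [|X Y /vfieldbP[tX sX] /vfieldbP[tY sY]]; apply/vfieldbP.
  split=> [p _|f]; last exact: smooth_on_cst.
  by split=> [a f g|f g] /=; rewrite !mulr0 addr0.
split=> [p _|f]; last exact: (smooth_onB openT (sX f) (sY f)).
have := tangent_comb 1 (-1) (tX p Logic.I) (tY p Logic.I).
by congr (tangent p _); apply/funext => f; rewrite mul1r mulN1r.
Qed.

End VectorFields.

Record vfield (R : realType) (n : nat) (M : manifold R n) := VField {
  vf_fun :> M -> smoothfun M -> R;
  vf_prop : vf_fun \in vfieldb }.
Arguments VField {R n M}.

Section VfieldModule.
Context {R : realType} {n : nat} {M : manifold R n}.
Implicit Types (X Y Z : vfield M) (f g : smoothfun M).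

HB.instance Definition _ := [isSub of vfield M for @vf_fun R n M].
HB.instance Definition _ := [Choice of vfield M by <:].
HB.instance Definition _ :=
  GRing.SubChoice_isSubZmodule.Build (M -> smoothfun M -> R) vfieldb (vfield M)
    vfieldb_zmod.

Lemma vf_tangent X p : tangent p (X p).
Proof. by have /vfieldbP[tX _] := vf_prop X; exact: tX. Qed.

Lemma vf_app_subproof X f : (fun p => X p f) \in smoothb.
Proof. by apply/smoothbP; have /vfieldbP[_] := vf_prop X; exact. Qed.

Definition vf_app X f : smoothfun M := SmoothFun _ (vf_app_subproof X f).

Lemma vf_scale_subproof f X : (fun p h => f p * X p h) \in vfieldb.
Proof.
apply/vfieldbP; split=> [p _|h].
  have := tangent_comb (f p) 0 (vf_tangent X p) (vf_tangent X p).
  by congr (tangent p _); apply/funext => h; rewrite mul0r addr0.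
apply: (@smooth_onM _ _ _ setT f (vf_app X h) openT).
  exact/smoothbP/sf_smooth.
exact/smoothbP/vf_app_subproof.
Qed.

Definition vf_scale f X : vfield M := VField _ (vf_scale_subproof f X).

Lemma vf_scaleA f g X : vf_scale f (vf_scale g X) = vf_scale (f * g) X.
Proof. by apply/val_inj/funext => p; apply/funext => h /=; rewrite mulrA. Qed.

Lemma vf_scale1 : left_id 1 vf_scale.
Proof.
by move=> X; apply/val_inj/funext => p; apply/funext => h /=; rewrite mul1r.
Qed.

Lemma vf_scaleDr : right_distributive vf_scale +%R.
Proof.
move=> f X Y; apply/val_inj/funext => p; apply/funext => h /=.
by rewrite mulrDr.
Qed.

Lemma vf_scaleDl X : {morph vf_scale^~ X : f g / f + g}.
Proof.
move=> f g; apply/val_inj/funext => p; apply/funext => h /=.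
by rewrite mulrDl.
Qed.

HB.instance Definition _ :=
  GRing.Zmodule_isLmodule.Build (smoothfun M) (vfield M)
    vf_scaleA vf_scale1 vf_scaleDr vf_scaleDl.

Lemma lie_subproof X Y :
  (fun p f => X p (vf_app Y f) - Y p (vf_app X f)) \in vfieldb.
Proof.
have appl Z (a : R) f g : vf_app Z (a *: f + g) = a *: vf_app Z f + vf_app Z g.
  apply/val_inj/funext => p /=; have [Zl _] := vf_tangent Z p; exact: Zl.
have appM Z f g : vf_app Z (f * g) = f * vf_app Z g + g * vf_app Z f.
  apply/val_inj/funext => p /=; have [_ ZM] := vf_tangent Z p; exact: ZM.
have addv Z p f g : Z p (f + g) = Z p f + Z p g.
  by have [Zl _] := vf_tangent Z p; have := Zl 1 f g; rewrite scale1r mul1r.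
apply/vfieldbP; split=> [p _|f].
  have [[Xl XM] [Yl YM]] := (vf_tangent X p, vf_tangent Y p).
  split=> [a f g|f g]; first by rewrite !appl Xl Yl; ring.
  by rewrite !appM !addv !XM !YM /=; ring.
apply: (@smooth_onB _ _ _ setT (vf_app X (vf_app Y f)) _ openT).
  exact/smoothbP/sf_smooth.
exact/smoothbP/(sf_smooth (vf_app Y (vf_app X f))).
Qed.

Definition lie X Y : vfield M := VField _ (lie_subproof X Y).

End VfieldModule.

Section Geometry.
Context {R : realType} {n : nat} {M : manifold R n}.
Implicit Types (E : M -> set (smoothfun M -> R)) (X Y Z : vfield M).

Definition section E X : Prop := forall p, E p (X p).

Definition is_basis (k : nat) (S : set (smoothfun M -> R))
    (e : 'I_k -> smoothfun M -> R) : Prop :=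
  injective (fun a : 'I_k -> R => \sum_i a i *: e i) /\
  S = range (fun a : 'I_k -> R => \sum_i a i *: e i).

(* Constant rank k and smoothness are both expressed by the local frames. *)
Record distribution (k : nat) := Distribution {
  dfib :> M -> set (smoothfun M -> R);
  dfib_frame : forall p, exists (U : set M) (e : 'I_k -> M -> smoothfun M -> R),
    [/\ open U, U p, forall i, smooth_vfield_on U (e i) &
        forall q, U q -> is_basis (dfib q) (fun i => e i q)] }.

Inductive iter_bracket E : vfield M -> Prop :=
| iter_section X : section E X -> iter_bracket E X
| iter_lie X Y : section E X -> iter_bracket E Y -> iter_bracket E (lie X Y).

Definition bracket_generating E : Prop :=
  forall (p : M) v, tangent p v ->
    exists (m : nat) (a : 'I_m -> R) (X : 'I_m -> vfield M),
      (forall i, iter_bracket E (X i)) /\ v = \sum_i a i *: X i p.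

(* The values of the form outside the fibres of E are irrelevant. *)
Record metric E := Metric {
  mform :> M -> (smoothfun M -> R) -> (smoothfun M -> R) -> R;
  mform_linear : forall p (a : R) u v w, E p u -> E p v -> E p w ->
    mform p (a *: u + v) w = a * mform p u w + mform p v w;
  mform_sym : forall p u v, E p u -> E p v -> mform p u v = mform p v u;
  mform_pos : forall p u, E p u -> u != 0 -> 0 < mform p u u;
  mform_smooth : forall X Y, section E X -> section E Y ->
    smooth_on setT (fun p => mform p (X p) (Y p)) }.

Record sub_riemannian := SubRiemannian {
  sr_rank : nat;
  sr_dist : distribution sr_rank;
  sr_bracket_generating : bracket_generating sr_dist;
  sr_metric : metric sr_dist }.

Definition riemannian_metric := metric (@tangent R n M).

Definition restricts_to E (g : riemannian_metric) (h : metric E) : Prop :=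
  forall p u v, E p u -> E p v -> g p u v = h p u v.

Lemma metric_app_subproof (g : riemannian_metric) X Y :
  (fun p => g p (X p) (Y p)) \in smoothb.
Proof. by apply/smoothbP; apply: mform_smooth => p; exact: vf_tangent. Qed.

Definition metric_app (g : riemannian_metric) X Y : smoothfun M :=
  SmoothFun _ (metric_app_subproof g X Y).

Definition orth (g : riemannian_metric) E : M -> set (smoothfun M -> R) :=
  fun p => [set v | tangent p v /\ forall w, E p w -> g p v w = 0].

(* The orthogonal projection as a relation: w is the projection of v to E p. *)
Definition is_orth_proj (g : riemannian_metric) E (p : M)
    (v w : smoothfun M -> R) : Prop :=
  E p w /\ orth g E p (v - w).

Implicit Type nabla : vfield M -> vfield M -> vfield M.

Definition linear_connection nabla : Prop :=
  [/\ forall (f : smoothfun M) X Y Z,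
        nabla (f *: X + Y) Z = f *: nabla X Z + nabla Y Z,
      forall X Y Z, nabla X (Y + Z) = nabla X Y + nabla X Z &
      forall (f : smoothfun M) X Y,
        nabla X (f *: Y) = vf_app X f *: Y + f *: nabla X Y].

(* (nabla_Z g)(X, Y) *)
Definition nabla_metric nabla (g : riemannian_metric) Z X Y : smoothfun M :=
  vf_app Z (metric_app g X Y)
  - metric_app g (nabla Z X) Y - metric_app g X (nabla Z Y).

Definition metric_connection nabla (g : riemannian_metric) : Prop :=
  linear_connection nabla /\ forall Z X Y, nabla_metric nabla g Z X Y = 0.

Definition preserves nabla E : Prop :=
  forall X Y, section E Y -> section E (nabla X Y).

Definition torsion nabla X Y : vfield M := nabla X Y - nabla Y X - lie X Y.

(* T^A_{BC} = 0, where A, B, C are subbundles of TM. *)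
Definition torsion_component_zero nabla (g : riemannian_metric)
    (A B C : M -> set (smoothfun M -> R)) : Prop :=
  forall X Y, section B X -> section C Y ->
    forall p, is_orth_proj g A p (torsion nabla X Y p) 0.

End Geometry.

Arguments sub_riemannian {R n} M.
Arguments riemannian_metric {R n} M.

(* Main.v *)
Require Import Defs.
From HB Require Import structures.
From mathcomp Require Import all_boot all_order all_algebra.
From mathcomp Require Import all_classical all_reals all_analysis.
From mathcomp Require Import ring lra.
Import Order.TTheory GRing.Theory Num.Theory.
Import numFieldNormedType.Exports.
Local Open Scope classical_set_scope.
Local Open Scope ring_scope.

Set Implicit Arguments.
Unset Strict Implicit.
Unset Printing Implicit Defensive.

(* Write [P] and [Q] for the orthogonal projections onto the distribution and
   onto its complement.  For a projection [P], the torsion conditions on the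
   image of [P] are the Levi-Civita condition along [P] and, along the kernel
   of [P], the vanishing of the skew part of the covariant derivative minus the
   Lie bracket; with metricity and the preservation of both subbundles they are
   equivalent to the single Koszul-type formula
     2 <nabla_X Y, Z> = X <PY, PZ> + <[X, PY], PZ> - <[X, PZ], PY>
                        + PY <PX, PZ> - PZ <PX, PY> - <[PY, PZ], PX>
   for Y and Z in the image of [P], and the right-hand side is a tensor in Z.
   Adding the formulas for [P] and [Q] determines nabla, and Riesz
   representation of the resulting functional of Z constructs it.

   The representing field is found on local frames with the adjugate of their
   Gram matrix.  For the tangent bundle, whose fibres are spaces of
   derivations, the coordinate fields are a frame by Hadamard's lemma, obtained
   here by differentiating under the integral sign. *)

Lemma morphD0 (U V : zmodType) (f : U -> V) : {morph f : x y / x + y} -> f 0 = 0.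
Proof. by move=> fD; apply: (addrI (f 0)); rewrite -fD !addr0. Qed.

(** * Directional and partial derivatives *)

Section Lines.
Context {R : realType} {V : normedModType R}.
Implicit Types (f : V -> R) (x v : V).

(** The two difference quotients are the same function of [h], so derivability and derivatives in
    the direction [v] reduce to the one-variable theory. *)
Lemma growth_line f x v (t : R) :
  (fun h : R => h^-1 *: ((f \o shift (t *: v + x)) (h *: v) - f (t *: v + x))) =
  (fun h : R => h^-1 *: (((fun s => f (s *: v + x)) \o shift t) (h *: (1 : R)) -
                         f (t *: v + x))).
Proof.
by apply/funext => h /=; rewrite addrA -scalerDl [_ *: 1]mulr1.
Qed.

Lemma derivable_line f x v (t : R) :
  derivable f (t *: v + x) v <-> derivable (fun s : R => f (s *: v + x)) t 1.
Proof. by rewrite /derivable growth_line. Qed.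

Lemma derive_line f x v (t : R) :
  'D_v f (t *: v + x) = 'D_1 (fun s : R => f (s *: v + x)) t.
Proof. by rewrite /derive growth_line. Qed.

Lemma is_derive_line f x v (t d : R) :
  is_derive (t *: v + x) v f d <-> is_derive t 1 (fun s : R => f (s *: v + x)) d.
Proof.
split=> -[df E]; (split; first exact/derivable_line).
  by rewrite -derive_line.
by rewrite derive_line.
Qed.

Lemma is_derive_line0 f x v (d : R) :
  is_derive x v f d <-> is_derive (0 : R) (1 : R) (fun s : R => f (s *: v + x)) d.
Proof. by rewrite -is_derive_line scale0r add0r. Qed.

(** The one-variable mean value theorem on [[0, s]] or [[s, 0]]. Derivability is asked on the
    symmetric segment, so that both signs of [s] share one statement. *)
Lemma MVT_line f x v (s : R) :
  (forall t : R, `|t| <= `|s| -> derivable f (t *: v + x) v) ->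
  exists2 t : R, `|t| <= `|s| & f (s *: v + x) - f x = s * 'D_v f (t *: v + x).
Proof.
move=> fd; pose F (t : R) := f (t *: v + x); pose F' (t : R) : R := 'D_v f (t *: v + x).
have dF (t : R) : `|t| <= `|s| -> is_derive t 1 F (F' t).
  by move=> ts; apply/is_derive_line/derivableP/fd.
have cF (t : R) : `|t| <= `|s| -> {for t, continuous F}.
  by move=> /dF[dFt _]; apply: differentiable_continuous; exact/derivable1_diffP.
have F0 : F 0 = f x by rewrite /F scale0r add0r.
have [s0|s0] := leP 0 s.
  have ts (t : R) : t \in `[0, s] -> `|t| <= `|s|.
    by rewrite in_itv/= => /andP[t0 ts]; rewrite !ger0_norm.
  have [||c cs E] := @MVT_segment R F F' 0 s s0.
  - by move=> t /subset_itv_oo_cc/ts/dF.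
  - by apply: continuous_in_subspaceT => t; rewrite inE => /ts/cF.
  by exists c; [exact: ts|rewrite -F0 E subr0 mulrC].
have ts (t : R) : t \in `[s, 0] -> `|t| <= `|s|.
  rewrite in_itv/= => /andP[t0 ts].
  by rewrite !ler0_norm// ?lerN2// ltW.
have [||c cs E] := @MVT_segment R F F' s 0 (ltW s0).
- by move=> t /subset_itv_oo_cc/ts/dF.
- by apply: continuous_in_subspaceT => t; rewrite inE => /ts/cF.
exists c; first exact: ts.
by rewrite -F0 -opprB E sub0r mulrN opprK mulrC.
Qed.

End Lines.

(** * Mean value theorem and chain rule from partial derivatives *)

Section Rn.
Context {R : realType} {n : nat}.
Implicit Types (f : 'rV[R]_n -> R) (x y k : 'rV[R]_n).

(** The increment is made one coordinate at a time, and [MVT_line] is applied on each axis-parallel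
    segment. All these segments stay in the box around [y] with half-widths [|k 0 j|]. *)
Lemma MVT_partial f y k :
  (forall z : 'rV[R]_n, (forall j, `|z 0 j - y 0 j| <= `|k 0 j|) ->
     forall i, derivable f z (delta_mx 0 i)) ->
  exists2 xi : 'I_n -> 'rV[R]_n,
    forall i j, `|xi i 0 j - y 0 j| <= `|k 0 j| &
    f (k + y) - f y = \sum_i k 0 i * 'D_(delta_mx 0 i) f (xi i).
Proof.
move=> fd.
(* The corner where the first [m] coordinates have been moved: [z 0] is [y] and [z n] is [k + y]. *)
pose z m : 'rV[R]_n := \row_j ((if (j < m)%N then k 0 j else 0) + y 0 j).
have step (i : 'I_n) : exists2 x : 'rV[R]_n, (forall j, `|x 0 j - y 0 j| <= `|k 0 j|) &
    f (z i.+1) - f (z i) = k 0 i * 'D_(delta_mx 0 i) f x.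
  have near_z t : `|t| <= `|k 0 i| ->
      forall j, `|(t *: delta_mx 0 i + z i) 0 j - y 0 j| <= `|k 0 j|.
    move=> tk j; rewrite !mxE eqxx /= addrA addrK.
    have [->|ji] := eqVneq j i; first by rewrite ltnn mulr1 addr0.
    by rewrite mulr0 add0r; case: ifP; rewrite ?normr0.
  have zS : z i.+1 = k 0 i *: delta_mx 0 i + z i.
    apply/rowP => j; rewrite !mxE eqxx /= ltnS leq_eqVlt.
    have [->|ji] := eqVneq j i; first by rewrite eqxx ltnn mulr1 add0r.
    by rewrite (_ : (j == i :> nat) = false) ?mulr0 ?add0r //; exact/negbTE.
  have [t tk E] := @MVT_line R _ f (z i) (delta_mx 0 i) (k 0 i)
    (fun t tk => fd _ (near_z t tk) i).
  by exists (t *: delta_mx 0 i + z i); [exact: near_z|rewrite zS].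
have /choice[xi xiP] (i : 'I_n) : exists x : 'rV[R]_n,
    (forall j, `|x 0 j - y 0 j| <= `|k 0 j|) /\
    f (z i.+1) - f (z i) = k 0 i * 'D_(delta_mx 0 i) f x.
  by have [x] := step i; exists x.
exists xi => [i|]; first by have [] := xiP i.
have -> : k + y = z n by apply/rowP => j; rewrite !mxE ltn_ord.
have -> : y = z 0%N by apply/rowP => j; rewrite !mxE add0r.
rewrite -(telescope_sumr (f \o z)) // big_mkord.
by apply: eq_bigr => i _; have [_ ->] := xiP i.
Qed.

Lemma rV_norm_le (x : 'rV[R]_n) (e : R) : 0 <= e ->
  (forall j, `|x 0 j| <= e) -> `|x| <= e.
Proof.
move=> e0 xe; rewrite [leLHS]/Num.norm /= mx_normrE; apply/bigmax_leP; split=> //.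
by move=> [i j] _ /=; rewrite ord1.
Qed.

Lemma rV_coord_le (x : 'rV[R]_n) j : `|x 0 j| <= `|x|.
Proof.
rewrite [leRHS]/Num.norm /= mx_normrE.
by apply/bigmax_geP; right => /=; exists (0, j).
Qed.

Lemma near_coordwise (P : set 'rV[R]_n) y : (\forall z \near y, P z) ->
  exists2 e : R, 0 < e & forall z : 'rV[R]_n, (forall j, `|z 0 j - y 0 j| < e) -> P z.
Proof.
move=> /nbhs_ballP[e /= e0 eP]; exists e => // z ze; apply: eP.
split=> // i j; rewrite ord1 -ball_normE /= distrC; exact: ze.
Qed.

(** [MVT_partial] writes the increment of [f \o c] through partial derivatives at intermediate
    points. These points are squeezed to [c t] as [h] tends to 0, where the partial derivatives are
    continuous. *)
Lemma is_derive_curve f (c : R -> 'rV[R]_n) (dc : 'rV[R]_n) (t : R) :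
  (\forall z \near c t, forall i, derivable f z (delta_mx 0 i)) ->
  (forall i, {for c t, continuous ('D_(delta_mx 0 i) f)}) ->
  (forall j, is_derive t 1 (fun s => c s 0 j) (dc 0 j)) ->
  is_derive t 1 (f \o c) (\sum_i dc 0 i * 'D_(delta_mx 0 i) f (c t)).
Proof.
move=> fd fc cd.
have [e e0 eP] := near_coordwise fd.
have cc j : (fun h : R => c (h + t) 0 j) @ 0^' --> c t 0 j.
  have [dj _] := cd j.
  have cj : {for t, continuous (fun s => c s 0 j)}.
    by apply: differentiable_continuous; exact/derivable1_diffP.
  have sh : h + t @[h --> (0 : R)] --> t.
    by rewrite -[X in _ --> X]add0r; apply: cvgD; [exact: cvg_id|exact: cvg_cst].
  by apply: cvg_within_filter; exact: (cvg_comp _ _ sh cj).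
pose good h xi := (forall i j : 'I_n, `|(xi i : 'rV[R]_n) 0 j - c t 0 j| <=
    `|c (h + t) 0 j - c t 0 j|) /\
  f (c (h + t)) - f (c t) =
    \sum_i (c (h + t) 0 i - c t 0 i) * 'D_(delta_mx 0 i) f (xi i).
(* For [h] taking the curve out of the neighbourhood where [f] is derivable, the intermediate points
   get the arbitrary value 0; only small [h] matter for the limit. *)
have /choice[xi xiP] (h : R) : exists x : 'I_n -> 'rV[R]_n,
    (forall j, `|c (h + t) 0 j - c t 0 j| < e) -> good h x.
  have [he|he] := pselect (forall j, `|c (h + t) 0 j - c t 0 j| < e).
    have [|x xd xE] := @MVT_partial f (c t) (c (h + t) - c t).
      move=> z zc; apply: eP => j; apply: le_lt_trans (zc j) _.
      by rewrite !mxE; exact: he.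
    exists x => _; split=> [i j|].
      by apply: le_trans (xd i j) _; rewrite !mxE.
    by rewrite subrK in xE; rewrite xE; apply: eq_bigr => i _; rewrite !mxE.
  by exists (fun=> 0).
have small : \forall h \near (0 : R)^', forall j, `|c (h + t) 0 j - c t 0 j| < e.
  apply: filter_forall => j.
  have /cvgrPdist_lt/(_ _ e0) := cc j.
  by apply: filterS => h; rewrite distrC.
have xic i : xi h i @[h --> (0 : R)^'] --> c t.
  apply/cvgrPdist_le => d d0.
  have cd' : \forall h \near (0 : R)^', forall j, `|c (h + t) 0 j - c t 0 j| <= d.
    apply: filter_forall => j.
    have /cvgrPdist_le/(_ _ d0) := cc j.
    by apply: filterS => h; rewrite distrC.
  apply: filterS2 small cd' => h hs hd.
  have [xd _] := xiP h hs; apply: rV_norm_le; first exact: ltW.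
  move=> j; rewrite !mxE distrC; exact: le_trans (xd i j) (hd j).
have lim : h^-1 *: (((f \o c) \o shift t) (h *: 1) - (f \o c) t) @[h --> (0:R)^'] -->
    \sum_i dc 0 i * 'D_(delta_mx 0 i) f (c t).
  have lim' : \sum_i ((h^-1 *: (c (h + t) 0 i - c t 0 i)) * 'D_(delta_mx 0 i) f (xi h i))
      @[h --> (0:R)^'] --> \sum_i dc 0 i * 'D_(delta_mx 0 i) f (c t).
    apply: cvg_big => [|i _]; first exact: add_continuous.
    apply: cvgM.
      have [/cvg_ex[l dl] E] := cd i.
      have := dl; rewrite -(cvg_lim (@norm_hausdorff _ _) dl).
      rewrite [X in _ --> X](_ : _ = dc 0 i); last by rewrite -E.
      by apply: cvg_trans; apply: near_eq_cvg; near=> h; rewrite /= [_ *: 1]mulr1.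
    exact: cvg_comp (xic i) (fc i).
  apply: cvg_trans lim'; apply: near_eq_cvg.
  apply: filterS small => h hs; rewrite /= [_ *: 1]mulr1.
  have [_ ->] := xiP h hs; rewrite scaler_sumr; apply: eq_bigr => i _.
  by rewrite scalerAl.
split; first by apply/cvg_ex; eexists; exact: lim.
exact: cvg_lim lim.
Unshelve. all: by end_near. Qed.

End Rn.

Lemma rV_cvg {R : realType} {n : nat} {T : Type} (F : set_system T) {FF : Filter F}
    (c : T -> 'rV[R]_n) (y : 'rV[R]_n) :
  (forall j, c t 0 j @[t --> F] --> y 0 j) -> c t @[t --> F] --> y.
Proof.
move=> cc; apply/cvgrPdist_le => e e0.
have ce : \forall t \near F, forall j, `|y 0 j - c t 0 j| <= e.
  by apply: filter_forall => j; have /cvgrPdist_le/(_ _ e0) := cc j.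
apply: filterS ce => t te; apply: rV_norm_le; first exact: ltW.
by move=> j; rewrite !mxE.
Qed.

(** The curve version applied to the restriction of [phi] to the line through [x] in the direction
    [v]. *)
Lemma is_derive_chain {R : realType} {n : nat} {V : normedModType R}
    (f : 'rV[R]_n -> R) (phi : V -> 'rV[R]_n) (dphi : 'rV[R]_n) (x v : V) :
  (\forall z \near phi x, forall i, derivable f z (delta_mx 0 i)) ->
  (forall i, {for phi x, continuous ('D_(delta_mx 0 i) f)}) ->
  (forall j, is_derive x v (fun y => phi y 0 j) (dphi 0 j)) ->
  is_derive x v (f \o phi) (\sum_i dphi 0 i * 'D_(delta_mx 0 i) f (phi x)).
Proof.
move=> fd fc pd; apply/is_derive_line0.
have E : phi (0 *: v + x) = phi x by rewrite scale0r add0r.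
have := @is_derive_curve R n f (fun s => phi (s *: v + x)) dphi 0.
rewrite E; apply=> // j.
exact/(@is_derive_line0 _ _ (fun y => phi y 0 j)).
Qed.

(** * Closure properties of functions of class C^k *)

Section Ck.
Context {R : realType} {n : nat}.
Implicit Types (U W : set 'rV[R]_n) (f g : 'rV[R]_n -> R).

Lemma Ck_sub k U W f : W `<=` U -> Ck k U f -> Ck k W f.
Proof.
move=> WU; elim: k f => [|k IH] f [fc fD]; split=> //.
1,2: by move=> x; rewrite inE => /WU xU; apply: fc; rewrite inE.
by move=> i; have [fi fDi] := fD i; split=> [x /WU /fi//|]; exact: IH.
Qed.

(** Continuity and derivability in [Ck] are those of the function on the whole space at points of
    the set; hence the sets [W] may be arbitrary. *)
Lemma Ck_local k U f :
  (forall x, U x -> exists2 W, W x & Ck k W f) -> Ck k U f.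
Proof.
elim: k f => [|k IH] f loc; split=> //.
1,2: by move=> x; rewrite inE => /loc[W Wx [fc _]]; apply: fc; rewrite inE.
move=> i; split=> [x /loc[W Wx [_ /(_ i)[fi _]]]|]; first exact: fi.
by apply: IH => x /loc[W Wx [_ /(_ i)[_ fDi]]]; exists W.
Qed.

Lemma Ck_derivable k U f x i : Ck k.+1 U f -> U x -> derivable f x (delta_mx 0 i).
Proof. by move=> [_ /(_ i)[+ _]]; exact. Qed.

Lemma Ck_derive k U f i : Ck k.+1 U f -> Ck k U ('D_(delta_mx 0 i) f).
Proof. by move=> [_ /(_ i)[]]. Qed.

Lemma Csmooth_derivable U f x i : Csmooth U f -> U x ->
  derivable f x (delta_mx 0 i).
Proof. by move=> /(_ 1) /Ck_derivable; exact. Qed.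

Lemma Csmooth_derive U f i : Csmooth U f -> Csmooth U ('D_(delta_mx 0 i) f).
Proof. by move=> fs k; exact: Ck_derive (fs k.+1). Qed.

Lemma Csmooth_cont U f x : Csmooth U f -> U x -> {for x, continuous f}.
Proof. by move=> /(_ 0)/Ck_cont fc Ux; apply: fc; rewrite inE. Qed.

Lemma Ck_sum k U (I : Type) (r : seq I) (F : I -> 'rV[R]_n -> R) : open U ->
  (forall i, Ck k U (F i)) -> Ck k U (fun x => \sum_(i <- r) F i x).
Proof.
move=> oU Fk; elim: r => [|i r IH].
  by apply: Ck_eq (Ck_cst k U 0) => // x _; rewrite big_nil.
by apply: Ck_eq (Ck_add oU (Fk i) IH) => // x _; rewrite big_cons.
Qed.

Lemma Ck_coord k U i : open U -> Ck k U (fun x : 'rV[R]_n => x 0 i).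
Proof.
move=> oU; have c : {in U, continuous (fun x : 'rV[R]_n => x 0 i)}.
  by move=> x _; exact: coord_continuous.
have d j (x : 'rV[R]_n) : is_derive x (delta_mx 0 j)
    (fun x : 'rV[R]_n => x 0 i) ((i == j)%:R).
  apply/is_derive_line0.
  rewrite (_ : (fun _ => _) = (fun s : R => s * (i == j)%:R + x 0 i)); last first.
    by apply/funext => s; rewrite !mxE eqxx.
  by apply: is_derive_eq; rewrite /GRing.scale /= mulr1 mulr0 addr0 add0r.
case: k => [|k]; split=> // j; split=> [x Ux|]; first by have [] := d j x.
apply: Ck_eq (Ck_cst k U (i == j)%:R) => // x _.
by have [_ ->] := d j x.
Qed.

End Ck.

Section Composition.
Context {R : realType} {m n : nat}.
Implicit Types (U : set 'rV[R]_m) (W : set 'rV[R]_n).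

(** By induction on [k] for all [f]: the chain rule turns a partial derivative of the composite into
    a sum of products, whose factors are partial derivatives of [phi] and composites of partial
    derivatives of [f] with [phi]. *)
Lemma Ck_comp k U W (phi : 'rV[R]_m -> 'rV[R]_n) (f : 'rV[R]_n -> R) :
  open U -> open W -> (forall x, U x -> W (phi x)) ->
  (forall j, Ck k U (fun x => phi x 0 j)) -> Ck k W f -> Ck k U (f \o phi).
Proof.
move=> oU oW UW; elim: k f => [|k IH] f pk fk.
all: have pc : {in U, continuous phi} by
  move=> x Ux; apply: (@rV_cvg R n _ (nbhs x) _ phi (phi x)) => j;
  exact: (Ck_cont (pk j) Ux).
all: have c : {in U, continuous (f \o phi)} by
  move=> x xU; have Ux : U x by [rewrite inE in xU];
  apply: (continuous_comp (pc x xU)); apply: (Ck_cont fk); rewrite inE; exact: UW.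
all: split=> // i.
pose d x : 'rV[R]_n := \row_j 'D_(delta_mx 0 i) (fun x => phi x 0 j) x.
have D x : U x -> is_derive x (delta_mx 0 i) (f \o phi)
    (\sum_j d x 0 j * 'D_(delta_mx 0 j) f (phi x)).
  move=> Ux; apply: is_derive_chain => [|j|j].
  - have : \forall z \near phi x, W z.
      by apply: open_nbhs_nbhs; split=> //; exact: UW.
    by apply: filterS => z Wz j; exact: Ck_derivable fk Wz.
  - by apply: (Ck_cont (Ck_derive j fk)); rewrite inE; exact: UW.
  - by rewrite mxE; apply/derivableP; exact: Ck_derivable (pk j) Ux.
split=> [x /D[]//|].
apply: (@Ck_eq _ _ _ _ (fun x => \sum_j (('D_(delta_mx 0 i) (fun x => phi x 0 j)) *
    ('D_(delta_mx 0 j) f \o phi)) x)) => // [x Ux|].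
  by have [_ ->] := D x Ux; apply: eq_bigr => j _; rewrite mxE.
apply: Ck_sum => // j; apply: Ck_mul => //; first exact: Ck_derive (pk j).
apply: IH => [l|]; first exact: Ck_pred (pk l).
exact: Ck_derive.
Qed.

End Composition.

Lemma Ck_inv {R : realType} {n : nat} k (U : set 'rV[R]_n) (f : 'rV[R]_n -> R) :
  open U -> (forall x, U x -> f x != 0) -> Ck k U f -> Ck k U (fun x => (f x)^-1).
Proof.
move=> oU f0; elim: k => [|k IH] fk.
all: have c : {in U, continuous (fun x => (f x)^-1)} by
  move=> x xU; apply: continuousV; [apply: f0; rewrite inE in xU|exact: (Ck_cont fk)].
all: split=> // i.
split=> [x Ux|]; first by apply: derivableV; [exact: f0|exact: Ck_derivable fk Ux].
have Vk := IH (Ck_pred fk).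
have N1 := Ck_cst k U (-1).
apply: Ck_eq (Ck_mul oU (Ck_mul oU N1 (Ck_mul oU Vk Vk)) (Ck_derive i fk)) => //.
move=> x Ux; rewrite deriveV; [|exact: f0|exact: Ck_derivable fk Ux].
by rewrite !fctE /= mulN1r -exprVn expr2.
Qed.

(** * A smooth bump function *)

Section Flat.
Context {R : realType}.
Implicit Types (t : R) (m : nat).

(* The derivatives of [t |-> exp (-1/t)] are combinations of these functions. *)
Definition flat m t : R := if 0 < t then t^-1 ^+ m * expR (- t^-1) else 0.

Lemma flat_ge0 m t : 0 <= flat m t.
Proof.
rewrite /flat; case: ifP => // t0.
by rewrite mulr_ge0 ?expR_ge0// exprn_ge0// invr_ge0 ltW.
Qed.

Lemma flat_eq0 m t : t <= 0 -> flat m t = 0.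
Proof. by move=> t0; rewrite /flat ltNge t0. Qed.

Lemma flat_gt0 m t : 0 < t -> 0 < flat m t.
Proof. by move=> t0; rewrite /flat t0 mulr_gt0 ?expR_gt0// exprn_gt0// invr_gt0. Qed.

(** One term of the exponential series at [1/t], of degree [m + 2], already dominates. The quadratic
    bound is what makes the derivative at 0 vanish. *)
Lemma flat_le m t : flat m t <= m.+2`!%:R * `|t| ^+ 2.
Proof.
have [t0|t0] := ltP 0 t; last by rewrite flat_eq0// mulr_ge0// exprn_ge0.
rewrite /flat t0 expRN gtr0_norm//.
have ti : 0 <= t^-1 by rewrite invr_ge0 ltW.
have := expR_ge1Dxn m.+1 ti.
have F0 : 0 < m.+2`!%:R :> R by rewrite ltr0n fact_gt0.
set e := expR _ => le; have e0 : 0 < e := expR_gt0 _.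
have {}le : t^-1 ^+ m.+2 <= m.+2`!%:R * e.
  by rewrite mulrC -ler_pdivrMr//; apply: le_trans le; rewrite lerDr.
rewrite ler_pdivrMr// mulrAC -ler_pdivrMr ?exprn_gt0//.
apply: le_trans le.
by rewrite -exprVn -exprD addn2.
Qed.

(** For [t < 0] the function is locally zero, for [t > 0] this is the product rule, and at 0 the
    difference quotient tends to 0 by [flat_le]. *)
Lemma is_derive_flat m t :
  is_derive t 1 (flat m) (flat m.+2 t - m%:R * flat m.+1 t).
Proof.
have [t0|t0|->] := ltgtP t 0.
- rewrite !flat_eq0 ?ltW// mulr0 subr0.
  apply: near_eq_is_derive (is_derive_cst (0 : R) t 1).
  near=> s; rewrite flat_eq0//; apply: ltW; near: s; exact: lt_nbhsl.
- have dV : is_derive t 1 (fun s : R => s^-1) (- t ^- 2).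
    split; first by apply: (@derivableV _ _ id) => //; rewrite gt_eqF.
    by rewrite (@deriveV _ _ id) ?gt_eqF// derive_id /GRing.scale /= mulr1.
  have dE : is_derive t 1 (fun s : R => expR (- s^-1)) (expR (- t^-1) * t ^- 2).
    apply: (@is_derive1_comp _ expR (fun s => - s^-1)).
    by rewrite -[X in is_derive _ _ _ X]opprK; exact: is_deriveN.
  have := @is_deriveM _ _ _ _ _ _ _ _ (@is_deriveX _ _ _ m _ _ _ dV) dE.
  have -> : flat m.+2 t - m%:R * flat m.+1 t =
    ((fun s : R => s^-1) ^+ m) t *: (expR (- t^-1) * t ^- 2) +
    expR (- t^-1) *: ((m%:R * t^-1 ^+ m.-1) *: - t ^- 2).
    rewrite /flat t0 !fctE /GRing.scale /= -exprVn.
    by case: m => [|m] /=; rewrite ?mul0r ?mulr0 ?expr0 ?exprS; ring.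
  apply: near_eq_is_derive.
  near=> s; have s0 : 0 < s by near: s; exact: lt_nbhsr.
  by rewrite /flat s0 !fctE.
have D : h^-1 *: ((flat m \o shift 0) (h *: 1) - flat m 0) @[h --> (0:R)^'] --> (0 : R).
  apply/cvgr0Pnorm_le => e e0.
  pose C : R := m.+2`!%:R; have C0 : 0 < C by rewrite ltr0n fact_gt0.
  have eC : 0 < e / C by rewrite divr_gt0.
  near=> h.
  have h0 : h != 0 by near: h; exact: nbhs_dnbhs_neq.
  have hn : 0 < `|h| by rewrite normr_gt0.
  rewrite /= addr0 [_ *: 1]mulr1 (flat_eq0 m (lexx 0)) subr0 normrM normfV.
  rewrite (ger0_norm (flat_ge0 _ _)) ler_pdivrMl//.
  apply: le_trans (flat_le m h) _; rewrite expr2 mulrCA ler_pM2l//.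
  rewrite mulrC -ler_pdivlMr//; apply: ltW.
  near: h; apply: dnbhs0_lt => //.
rewrite !(flat_eq0 _ (lexx 0)) mulr0 subr0.
split; first by apply/cvg_ex; eexists; exact: D.
exact: cvg_lim D.
Unshelve. all: by end_near. Qed.

(** The induction on [k] runs over all [m] at once, since differentiation raises the index to
    [m + 1] and [m + 2]. *)
Lemma Ck_flat {n : nat} k (U : set 'rV[R]_n) m (f : 'rV[R]_n -> R) : open U ->
  Ck k U f -> Ck k U (flat m \o f).
Proof.
move=> oU; elim: k m => [|k IH] m fk.
all: have c : {in U, continuous (flat m \o f)} by
  move=> x xU; apply: (continuous_comp ((Ck_cont fk) x xU));
  apply: differentiable_continuous; apply/derivable1_diffP;
  have [] := is_derive_flat m (f x).
all: split=> // i.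
have fk' := Ck_pred fk.
have D x : U x -> is_derive x (delta_mx 0 i) (flat m \o f)
    ((flat m.+2 (f x) - m%:R * flat m.+1 (f x)) * 'D_(delta_mx 0 i) f x).
  move=> Ux; have /is_derive_line0 fd := derivableP (@Ck_derivable _ _ k U f x i fk Ux).
  apply/is_derive_line0.
  apply: (@is_derive1_comp _ (flat m) (fun s : R => f (s *: delta_mx 0 i + x))) fd.
  by rewrite scale0r add0r; exact: is_derive_flat.
split=> [x /D[]//|].
apply: Ck_eq (Ck_mul oU (Ck_add oU (IH m.+2 fk')
  (Ck_mul oU (Ck_cst k U (- m%:R)) (IH m.+1 fk'))) (Ck_derive i fk)) => // x Ux.
by have [_ ->] := D x Ux; rewrite !fctE /= mulNr.
Qed.

End Flat.

(** The function is [flat 0] of [r^2] minus the squared Euclidean distance to [a]. The norm in the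
    last clause is the maximum norm, which the Euclidean one dominates. *)
Lemma Csmooth_bump {R : realType} {n : nat} (a : 'rV[R]_n) (r : R) : 0 < r ->
  exists b : 'rV[R]_n -> R, [/\ Csmooth setT b, forall x, 0 <= b x, 0 < b a &
    forall x, b x != 0 -> `|x - a| <= r].
Proof.
move=> r0; exists (flat 0 \o (fun x => r ^+ 2 - \sum_i (x 0 i - a 0 i) ^+ 2)); split.
- move=> k; apply: Ck_flat; first exact: openT.
  apply: (@Ck_eq _ _ _ _ (cst (r ^+ 2) + cst (-1) *
      (fun x => \sum_i (((fun x : 'rV[R]_n => x 0 i) + cst (- a 0 i)) *
                       ((fun x : 'rV[R]_n => x 0 i) + cst (- a 0 i))) x))).
  + exact: openT.
  + by move=> x _; rewrite !fctE /= mulN1r; congr (_ - _); apply: eq_bigr.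
  + have o := @openT 'rV[R]_n.
    apply: Ck_add => //; first exact: Ck_cst.
    apply: Ck_mul => //; first exact: Ck_cst.
    apply: Ck_sum => // i.
    by apply: Ck_mul => //; apply: Ck_add => //; solve [exact: Ck_coord | exact: Ck_cst].
- by move=> x; exact: flat_ge0.
- apply: flat_gt0; rewrite big1 ?subr0 ?exprn_gt0// => i _.
  by rewrite subrr expr0n.
- move=> x bx; apply: rV_norm_le; first exact: ltW.
  move=> j; rewrite !mxE.
  have le : \sum_i (x 0 i - a 0 i) ^+ 2 <= r ^+ 2.
    rewrite -subr_ge0 leNgt; apply: contra bx => neg.
    by rewrite /= flat_eq0// ltW.
  rewrite -(@ler_pXn2r _ 2)// ?nnegrE ?(ltW r0)// real_normK ?num_real//.
  apply: le_trans le; rewrite (bigD1 j)//= lerDl; apply: sumr_ge0 => i _.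
  exact: sqr_ge0.
Qed.

(** * Hadamard's lemma *)

Lemma compact_normball {R : realType} {n : nat} (a : 'rV[R]_n) (r : R) :
  compact [set x | `|x - a| <= r].
Proof.
pose K : set 'rV[R]_n := [set x | `|x - a| <= r].
rewrite -/K; apply: bounded_closed_compact.
  exists (r + `|a|); split; first exact: num_real.
  move=> N ltN x Kx; apply: ltW; apply: le_lt_trans ltN.
  rewrite -[x in leLHS](subrK a); apply: le_trans (ler_normD _ _) _.
  by rewrite lerD2r.
have -> : K = (fun x => `|x - a|) @^-1` [set t | t <= r] by [].
apply: preimage_closed; last exact: closed_le.
move=> x _; apply: (@continuous_comp _ _ _ (fun x : 'rV[R]_n => x - a)
  (fun x : 'rV[R]_n => `|x|)).
  by apply: (@continuousB _ _ _ id (cst a)); [exact: cvg_id|exact: cst_continuous].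
exact: norm_continuous.
Qed.

Section Hadamard.
Context {R : realType} {n : nat}.
Variables (a : 'rV[R]_n) (r : R).
Implicit Types (F : 'rV[R]_n -> R) (x : 'rV[R]_n) (m : nat) (t : R).

Local Notation mu := (@lebesgue_measure R).
Let U : set 'rV[R]_n := [set x | `|x - a| < r].

Definition ray x t : 'rV[R]_n := t *: (x - a) + a.

Lemma open_normball : open U.
Proof.
have -> : U = ball a r by apply/seteqP; split=> x; rewrite /U -ball_normE /= distrC.
exact: ball_open.
Qed.

Let itv01P t : t \in (`[0, 1] : interval R) -> 0 <= t <= 1.
Proof. by rewrite in_itv. Qed.

Let ray_norm x t : 0 <= t <= 1 -> `|ray x t - a| <= `|x - a|.
Proof.
move=> /andP[t0 t1]; rewrite /ray addrK normrZ ger0_norm//.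
by rewrite ler_piMl.
Qed.

Let ray_ball x t : U x -> 0 <= t <= 1 -> U (ray x t).
Proof. by move=> Ux /(ray_norm x) le; exact: le_lt_trans le Ux. Qed.

Let is_derive_ray F x t : Csmooth U F -> U (ray x t) ->
  is_derive t 1 (F \o ray x)
    (\sum_i (x - a) 0 i * 'D_(delta_mx 0 i) F (ray x t)).
Proof.
move=> sF Ur; apply: is_derive_curve => [|i|j].
- have : \forall z \near ray x t, U z.
    by apply: open_nbhs_nbhs; split=> //; exact: open_normball.
  by apply: filterS => z Uz i; exact: Csmooth_derivable sF Uz.
- exact: Csmooth_cont (Csmooth_derive i sF) Ur.
- rewrite (_ : (fun _ => _) = (fun s => s * (x - a) 0 j + a 0 j)); last first.
    by apply/funext => s; rewrite !mxE.
  by apply: is_derive_eq; rewrite /GRing.scale /= mulr1 mulr0 addr0 add0r.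
Qed.

Let ray_cont F x t : Csmooth U F -> U (ray x t) -> {for t, continuous (F \o ray x)}.
Proof.
move=> sF Ur; apply: differentiable_continuous; apply/derivable1_diffP.
by have [] := is_derive_ray sF Ur.
Qed.

Let moment_cont m F x : Csmooth U F -> U x ->
  {within `[0, 1], continuous (fun t => t ^+ m * F (ray x t) : R)}.
Proof.
move=> sF Ux; apply: continuous_in_subspaceT => t; rewrite inE => /itv01P t01.
apply: (@continuousM _ _ (fun t : R => t ^+ m) (F \o ray x)).
  exact: exprn_continuous.
by apply: ray_cont => //; exact: ray_ball.
Qed.

Let moment_integrable m F x : Csmooth U F -> U x ->
  mu.-integrable `[0, 1] (EFin \o (fun t => t ^+ m * F (ray x t))).
Proof.
move=> sF Ux; apply: continuous_compact_integrable; first exact: segment_compact.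
exact: moment_cont.
Qed.

Let bounded_on F (rho : R) : rho < r -> Csmooth U F ->
  exists C : R, forall x, `|x - a| <= rho -> `|F x| <= C.
Proof.
move=> rhor sF; have [rho0|rho0] := ltP rho 0.
  by exists 0 => x xr; have := le_trans (normr_ge0 _) xr; rewrite leNgt rho0.
pose K : set 'rV[R]_n := [set x | `|x - a| <= rho].
have [|||c cK le] := @EVT_max_rV R n (fun x => `|F x|) K.
- by exists a; rewrite /K /= subrr normr0.
- exact: compact_normball.
- apply: continuous_in_subspaceT => x; rewrite inE => Kx.
  apply: (@continuous_comp _ _ _ F (fun t : R => `|t|)); last exact: norm_continuous.
  by apply: (Csmooth_cont sF); exact: le_lt_trans Kx rhor.
- by exists `|F c| => x Kx; apply: le; rewrite inE.
Qed.

(* The family is closed under partial derivatives. *)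
Definition moment m F x : R := \int[mu]_(t in `[0, 1]) (t ^+ m * F (ray x t)).

Let mu1 : fine (mu `[0%R, 1%R]%classic) = 1.
Proof. by rewrite lebesgue_measure_itv/= lte01 /= subr0. Qed.

Let moment_le m F (C : R) x : Csmooth U F -> U x ->
  (forall y, `|y - a| <= `|x - a| -> `|F y| <= C) -> `|moment m F x| <= C.
Proof.
move=> sF Ux FC.
have i01 := moment_integrable m sF Ux.
rewrite /moment; apply: le_trans (le_normr_Rintegral _ i01) _ => //.
have EC : C = \int[mu]_(t in `[0, 1]) cst C t by rewrite Rintegral_cst// mu1 mulr1.
rewrite [leRHS]EC; apply: le_Rintegral => //.
- have := integrable_norm (moment_integrable m sF Ux).
  by congr (_.-integrable _ _); apply/funext.
- apply: continuous_compact_integrable; first exact: segment_compact.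
  by apply: continuous_subspaceT => t; exact: cst_continuous.
- move=> t /itv01P t01; rewrite normrM normrX -[leRHS]mul1r.
  have /andP[t0 t1] := t01.
  apply: ler_pM => //.
    by rewrite ger0_norm// exprn_ile1.
  by apply: FC; exact: ray_norm.
Qed.

(** Differentiation under the integral sign. Moving [x] by [s] along an axis moves the point at time
    [t] of the segment by [s * t], whence the extra factor [t] and the index [m + 1]. *)
Lemma is_derive_moment m F x i : Csmooth U F -> U x ->
  is_derive x (delta_mx 0 i) (moment m F) (moment m.+1 ('D_(delta_mx 0 i) F) x).
Proof.
move=> sF Ux; apply/is_derive_line0.
(* Half the distance left to the sphere: the perturbed points stay in a closed ball strictly inside
   [U], and by compactness the partial derivative has there a constant bound, which serves as the
   dominating function. *)
pose e : R := (r - `|x - a|) / 2.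
have e0 : 0 < e by rewrite divr_gt0// subr_gt0.
have near_x s : s \in (`]- e, e[ : interval R) ->
    `|s *: delta_mx 0 i + x - a| <= `|x - a| + e.
  rewrite in_itv /= -ltr_norml => /ltW se.
  rewrite -addrA addrC; apply: le_trans (ler_normD _ _) _; rewrite lerD2l.
  apply: rV_norm_le => [|j]; first exact: ltW.
  rewrite !mxE normrM eqxx /=; case: (j == i); rewrite ?normr1 ?mulr1//.
  by rewrite normr0 mulr0 ltW.
have rhor : `|x - a| + e < r.
  by rewrite /e; have : `|x - a| < r := Ux; lra.
have Us s : s \in (`]- e, e[ : interval R) -> U (s *: delta_mx 0 i + x).
  by move=> /near_x le; exact: le_lt_trans le rhor.
have [C CP] := bounded_on rhor (Csmooth_derive i sF).
pose h (s t : R) := t ^+ m * F (ray (s *: delta_mx 0 i + x) t).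
pose h' (s t : R) := t ^+ m.+1 * 'D_(delta_mx 0 i) F (ray (s *: delta_mx 0 i + x) t).
have dh s t : s \in (`]- e, e[ : interval R) -> 0 <= t <= 1 ->
    is_derive s 1 (h ^~ t) (h' s t).
  move=> se t01; rewrite /h /h'.
  have rayE u : ray (u *: delta_mx 0 i + x) t = (u * t) *: delta_mx 0 i + ray x t.
    by rewrite /ray -addrA scalerDr scalerA mulrC addrA.
  have Ur : U ((s * t) *: delta_mx 0 i + ray x t).
    by rewrite -(rayE s); apply: ray_ball => //; exact: Us.
  have /is_derive_line dF := derivableP (@Csmooth_derivable _ _ U F _ i sF Ur).
  have dl : is_derive s 1 (fun u : R => u * t) t.
    by apply: is_derive_eq; rewrite /GRing.scale /= mulr1 mulr0 add0r.
  rewrite (_ : (fun _ => _) = (fun u => t ^+ m *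
      ((fun u : R => F (u *: delta_mx 0 i + ray x t)) \o (fun u : R => u * t)) u)).
    2: by apply/funext => u; rewrite rayE.
  rewrite (rayE s).
  have := @is_derive1_comp R (fun u : R => F (u *: delta_mx 0 i + ray x t))
    (fun u : R => u * t) s _ _ dF dl.
  move=> d; have := is_deriveZ (t ^+ m) d.
  by rewrite exprSr /GRing.scale /= -mulrA (mulrC t).
have dhE s t : s \in (`]- e, e[ : interval R) -> 0 <= t <= 1 ->
    partial1of2 h s t = h' s t.
  by move=> se t01; rewrite partial1of2E; have [_ ->] := dh s t se t01.
have z : `]- e, e[%classic 0 by rewrite /= in_itv /= oppr_lt0 e0.
have ih s : `]- e, e[%classic s -> mu.-integrable `[0, 1] (EFin \o h s).
  by move=> se; apply: moment_integrable => //; exact: Us.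
have dh1 s t : `]- e, e[%classic s -> `[0, 1]%classic t -> derivable (h ^~ t) s 1.
  by move=> se /itv01P t01; have [] := dh s t se t01.
have C0 : 0 <= C.
  apply: le_trans (CP x _); first exact: normr_ge0.
  by rewrite lerDl ltW.
have bd s t : `]- e, e[%classic s -> `[0, 1]%classic t ->
    `|partial1of2 h s t| <= cst C t.
  move=> se /itv01P t01; rewrite dhE// /h' normrM normrX -[leRHS]mul1r.
  have /andP[t0 t1] := t01.
  apply: ler_pM => //.
    by rewrite ger0_norm// exprn_ile1.
  by apply: CP; apply: le_trans (near_x s se); exact: ray_norm.
have iC : mu.-integrable `[0, 1] (EFin \o cst C).
  apply: continuous_compact_integrable; first exact: segment_compact.
  by apply: continuous_subspaceT => t; exact: cst_continuous.
have E : \int[mu]_(t in `[0, 1]) partial1of2 h 0 t = moment m.+1 ('D_(delta_mx 0 i) F) x.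
  apply: eq_Rintegral => t; rewrite inE => /itv01P t01.
  by rewrite dhE// /h' scale0r add0r.
split.
  by apply: (@derivable_under_integral _ _ _ mu h _ _ 0 (- e) e z ih
    dh1 _ (fun=> C0) iC bd).
rewrite -E -derive1E.
by apply: (@differentiation_under_integral _ _ _ mu h _ _ 0 (- e) e z ih
  dh1 _ (fun=> C0) iC bd).
Qed.

(** The partial derivatives of the moment are bounded near [x], so [MVT_partial] gives a Lipschitz
    estimate at [x]. *)
Let moment_continuous m F x : Csmooth U F -> U x -> {for x, continuous (moment m F)}.
Proof.
move=> sF Ux.
pose e : R := (r - `|x - a|) / 2.
have e0 : 0 < e by rewrite divr_gt0// subr_gt0.
have rhor : `|x - a| + e < r.
  by rewrite /e; have : `|x - a| < r := Ux; lra.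
have near_x y : `|y - x| <= e -> `|y - a| <= `|x - a| + e.
  move=> ye; rewrite -(subrK x y) -addrA addrC; apply: le_trans (ler_normD _ _) _.
  by rewrite lerD2l.
have /choice[C CP] i := bounded_on rhor (Csmooth_derive i sF).
(* The Lipschitz constant; adding 1 makes it positive, so that it can be divided by. *)
pose S := \sum_i `|C i| + 1.
have S0 : 0 < S by rewrite ltr_wpDl// sumr_ge0.
apply/(@cvgrPdist_le _ _ _ (nbhs x) (nbhs_filter x)) => d d0; near=> y.
have ye : `|y - x| <= e.
  rewrite distrC; near: y; exact: cvgr_dist_le.
have [|xi xid E] := @MVT_partial R n (moment m F) x (y - x).
  move=> z zy i.
  have [] // := @is_derive_moment m F z i sF.
  apply: le_lt_trans rhor; apply: near_x; apply: rV_norm_le; first exact: ltW.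
  move=> j; rewrite !mxE; apply: le_trans (zy j) _.
  by apply: le_trans ye; exact: rV_coord_le.
rewrite distrC -[y in leLHS](subrK x) E.
have Cxi i : `|'D_(delta_mx 0 i) (moment m F) (xi i)| <= C i.
  have le : `|xi i - a| <= `|x - a| + e.
    apply: near_x; apply: rV_norm_le; first exact: ltW.
    move=> j; rewrite !mxE; apply: le_trans (xid i j) _.
    by apply: le_trans ye; exact: rV_coord_le.
  have Uxi : U (xi i) by exact: le_lt_trans le rhor.
  have [_ ->] := @is_derive_moment m F (xi i) i sF Uxi.
  apply: moment_le => //; first exact: Csmooth_derive.
  by move=> z zle; apply: CP; exact: le_trans zle le.
apply: le_trans (ler_norm_sum _ _ _) _.
have le : \sum_i `|(y - x) 0 i * 'D_(delta_mx 0 i) (moment m F) (xi i)| <=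
    `|y - x| * S.
  rewrite /S mulrDr ler_wpDr ?mulr1//.
  rewrite mulr_sumr; apply: ler_sum => i _; rewrite normrM.
  apply: ler_pM => //; first exact: rV_coord_le.
  exact: le_trans (Cxi i) (ler_norm _).
apply: le_trans le _; rewrite -ler_pdivlMr//.
by rewrite distrC; near: y; apply: cvgr_dist_le => //; rewrite divr_gt0.
Unshelve. all: by end_near. Qed.

Lemma Csmooth_moment m F : Csmooth U F -> Csmooth U (moment m F).
Proof.
move=> sF k; elim: k m F sF => [|k IH] m F sF.
all: have c : {in U, continuous (moment m F)} by
  move=> x; rewrite inE => Ux; exact: moment_continuous.
all: split=> // i; split=> [x Ux|].
  by have [] := @is_derive_moment m F x i sF Ux.
apply: Ck_eq (IH m.+1 _ (Csmooth_derive i sF)) => [|x Ux].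
  exact: open_normball.
by have [_ ->] := @is_derive_moment m F x i sF Ux.
Qed.

(** The factor [g i] is the integral of the [i]-th partial derivative along the segment from [a] to
    [x]. The identity is the fundamental theorem of calculus for [f] on that segment. *)
Lemma hadamard f : Csmooth U f -> exists g : 'I_n -> 'rV[R]_n -> R,
  [/\ forall i, Csmooth U (g i),
      forall i, g i a = 'D_(delta_mx 0 i) f a &
      forall x, U x -> f x = f a + \sum_i (x 0 i - a 0 i) * g i x].
Proof.
move=> sf; exists (fun i => moment 0 ('D_(delta_mx 0 i) f)).
have sD i := Csmooth_derive i sf.
split=> [i|i|x Ux]; first exact: Csmooth_moment.
  rewrite /moment; under eq_Rintegral do rewrite expr0 mul1r /ray subrr scaler0 add0r.
  by rewrite Rintegral_cst// mu1 mulr1.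
pose df t : R := \sum_i (x - a) 0 i * 'D_(delta_mx 0 i) f (ray x t).
have Ur t : 0 <= t <= 1 -> U (ray x t) by exact: ray_ball.
have d t : 0 <= t <= 1 -> is_derive t 1 (f \o ray x) (df t).
  by move=> t01; apply: is_derive_ray => //; exact: Ur.
have c t : 0 <= t <= 1 -> {for t, continuous (f \o ray x)}.
  by move=> t01; apply: ray_cont => //; exact: Ur.
have cdf : {within `[0, 1], continuous df}.
  apply: continuous_in_subspaceT => t; rewrite inE => /itv01P t01.
  rewrite /prop_for /continuous_at /df.
  apply: (@cvg_big _ _ _ _ _ _ _ (nbhs t)) => [|i _]; first exact: add_continuous.
  apply: cvgM; first exact: cvg_cst.
  exact: (ray_cont (sD i) (Ur t t01)).
have iD i : mu.-integrable `[0, 1]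
    (EFin \o (fun t => (x - a) 0 i * 'D_(delta_mx 0 i) f (ray x t))).
  apply: continuous_compact_integrable; first exact: segment_compact.
  apply: continuous_in_subspaceT => t; rewrite inE => /itv01P t01.
  apply: cvgM; first exact: cvg_cst.
  exact: (ray_cont (sD i) (Ur t t01)).
have ftc : (\int[mu]_(t in `[0%R, 1%R]) (df t)%:E)%E = ((f x)%:E - (f a)%:E)%E.
  rewrite (@continuous_FTC2 _ df (f \o ray x)) //.
  - by rewrite /= /ray scale1r subrK scale0r add0r.
  - split.
    + by move=> t /subset_itv_oo_cc /itv01P t01; have [] := d t t01.
    + by apply: cvg_at_right_filter; apply: c; rewrite lexx ler01.
    + by apply: cvg_at_left_filter; apply: c; rewrite lexx ler01.
  - move=> t /subset_itv_oo_cc /itv01P t01.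
    by rewrite derive1E; have [_ ->] := d t t01.
have : f x - f a = \int[mu]_(t in `[0, 1]) df t by rewrite /Rintegral ftc.
move=> /eqP; rewrite subr_eq addrC => /eqP ->; congr (_ + _).
rewrite /Rintegral.
under eq_integral do rewrite -sumEFin.
rewrite integral_sum//.
rewrite -sum_fine => [|i _]; last first.
  by apply: integrable_fin_num => //; exact: iD.
apply: eq_bigr => i _.
rewrite -[fine _]/(\int[mu]_(t in `[0, 1]) ((x - a) 0 i * 'D_(delta_mx 0 i) f (ray x t))).
rewrite RintegralZl //.
  by rewrite !mxE; congr (_ * _); apply: eq_Rintegral => t _; rewrite expr0 mul1r.
have := moment_integrable 0 (sD i) Ux.
by congr (_.-integrable _ _); apply/funext => t /=; rewrite expr0 mul1r.
Qed.

End Hadamard.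

(** * Localization and bump functions on a manifold *)

Section SmoothLocal.
Context {R : realType} {n : nat} {M : manifold R n}.
Implicit Types (U W : set M) (f g : M -> R) (c : chart R n M) (p q : M).

Lemma smooth_on_local U f :
  (forall p, U p -> exists2 W, W p & smooth_on W f) -> smooth_on U f.
Proof.
move=> loc c ac k; apply: Ck_local => _ [p [Up cp] <-].
have [W Wp sW] := loc p Up.
by exists (cmap c @` (W `&` cdom c)); [exists p|exact: sW].
Qed.

Lemma smooth_on_sub U W f : W `<=` U -> smooth_on U f -> smooth_on W f.
Proof.
move=> WU sf c ac k; apply: Ck_sub (sf c ac k) => _ [p [Wp cp] <-].
by exists p; split=> //; exact: WU.
Qed.

Lemma smooth_on_eq U f g : open U -> (forall p, U p -> f p = g p) ->
  smooth_on U f -> smooth_on U g.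
Proof.
move=> oU fg sf c ac k; apply: Ck_eq (sf c ac k); first exact: chart_img_open.
by move=> _ [p [Up cp] <-] /=; rewrite cmapK ?inE//; exact: fg.
Qed.

(** One chart suffices: in any other chart [d], [f] is its expression in [c] composed with a
    transition map, which is smooth by compatibility of the atlas. *)
Lemma smooth_on_chart c W f : atlas c -> open W -> W `<=` cdom c ->
  Csmooth (cmap c @` W) (f \o cinv c) -> smooth_on W f.
Proof.
move=> ac oW Wc sf d ad k.
have Wdc : cmap d @` (W `&` cdom d) `<=` cmap d @` (cdom d `&` cdom c).
  by move=> _ [p [Wp dp] <-]; exists p; split=> //; exact: Wc.
have oc : open (cmap c @` W).
  have := @chart_img_open _ _ _ c _ oW; congr (open (_ @` _)).
  by apply/setIidPl.
apply: (@Ck_eq _ _ _ _ ((f \o cinv c) \o (cmap c \o cinv d))).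
- exact: chart_img_open.
- move=> _ [p [Wp dp] <-] /=; rewrite (cmapK (c := d)) ?inE//.
  by rewrite (cmapK (c := c)) ?inE//; exact: Wc.
- apply: (@Ck_comp _ _ _ _ _ (cmap c @` W)) => //.
  + exact: chart_img_open.
  + move=> _ [p [Wp dp] <-] /=; rewrite cmapK ?inE//; by exists p.
  + by move=> j; apply: Ck_sub Wdc _; exact: atlas_compat.
Qed.

Definition chart_ext c (V : set 'rV[R]_n) (h : 'rV[R]_n -> R) : M -> R :=
  fun q => if `[< cdom c q /\ V (cmap c q) >] then h (cmap c q) else 0.

Lemma chart_extE c V h q : cdom c q -> V (cmap c q) -> chart_ext c V h q = h (cmap c q).
Proof. by move=> cq Vq; rewrite /chart_ext; case: asboolP => // -[]. Qed.

Lemma chart_ext_out c V h q : ~ (cdom c q /\ V (cmap c q)) -> chart_ext c V h q = 0.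
Proof. by rewrite /chart_ext; case: asboolP. Qed.

Lemma open_chart_preim c (V : set 'rV[R]_n) : open V ->
  open [set q | cdom c q /\ V (cmap c q)].
Proof.
move=> oV; rewrite openE => q [cq Vq].
have nc : nbhs q (cdom c) by apply: open_nbhs_nbhs; split=> //; exact: cdom_open.
have nV : nbhs q (cmap c @^-1` V).
  by apply: (cmap_continuous (c := c)); [rewrite inE|exact: open_nbhs_nbhs].
exact: filterI nc nV.
Qed.

(** The image is compact, hence closed because the manifold is Hausdorff. This makes extension by
    zero from a chart smooth. *)
Lemma closed_chart_img c (K : set 'rV[R]_n) : compact K -> K `<=` cmap c @` cdom c ->
  closed (cinv c @` K).
Proof.
move=> cK Kc; apply: compact_closed; first exact: mspace_hausdorff.
apply: continuous_compact => //; apply: continuous_in_subspaceT => x.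
by rewrite inE => /Kc cx; apply: cinv_continuous; rewrite inE.
Qed.

(** Two open sets cover the manifold: the part of the chart over [V], where the function is [h] in
    coordinates, and the complement of the closed image of [K], where it is zero. *)
Lemma chart_ext_smooth c (V K : set 'rV[R]_n) h : atlas c -> open V ->
  V `<=` cmap c @` cdom c -> compact K -> K `<=` V -> Csmooth V h ->
  (forall x, V x -> ~ K x -> h x = 0) -> smooth_on setT (chart_ext c V h).
Proof.
move=> ac oV Vc cK KV sh h0; apply: smooth_on_local => p _.
have clK : closed (cinv c @` K).
  by apply: closed_chart_img => // x /KV /Vc.
have [[x Kx xp]|nK] := pselect ((cinv c @` K) p).
  exists [set q | cdom c q /\ V (cmap c q)].
    have [q cq qx] := Vc _ (KV _ Kx).
    by rewrite -xp -qx cmapK ?inE//= qx; split=> //; exact: KV.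
  apply: (@smooth_on_chart c) => //; first exact: open_chart_preim.
    by move=> q [].
  move=> k; apply: (@Ck_eq _ _ _ _ h).
  + have := @chart_img_open _ _ _ c _ (open_chart_preim c oV); congr (open (_ @` _)).
    by apply/setIidPl => q [].
  + by move=> _ [q [cq Vq] <-] /=; rewrite cmapK ?inE// chart_extE.
  + by apply: Ck_sub (sh k) => _ [q [cq Vq] <-].
exists (~` (cinv c @` K)) => //.
apply: (@smooth_on_eq _ (cst 0)); first exact: closed_openC.
- move=> q nKq; have [[cq Vq]|n'] := pselect (cdom c q /\ V (cmap c q)).
    rewrite chart_extE// h0// => Kq; apply: nKq; exists (cmap c q) => //.
    by rewrite cmapK ?inE.
  by rewrite chart_ext_out.
- exact: smooth_on_cst.
Qed.

Lemma Csmooth_smoothfun (f : smoothfun M) c : atlas c ->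
  Csmooth (cmap c @` cdom c) (f \o cinv c).
Proof.
move=> ac; have /smoothbP := sf_smooth f; move=> /(_ c ac).
by rewrite setTI.
Qed.

End SmoothLocal.

Section Bumps.
Context {R : realType} {n : nat} {M : manifold R n}.
Implicit Types (U W : set M) (c : chart R n M) (p q : M).

Lemma chart_bump c U p : atlas c -> open U -> U p -> cdom c p ->
  exists (r : R) (b : 'rV[R]_n -> R), let V := [set x | `|x - cmap c p| < r] in
  [/\ 0 < r, V `<=` cmap c @` (U `&` cdom c), Csmooth V b, 0 < b (cmap c p) &
     exists K, [/\ compact K, K `<=` V & forall x, ~ K x -> b x = 0]].
Proof.
move=> ac oU Up cp.
have : nbhs (cmap c p) (cmap c @` (U `&` cdom c)).
  by apply: open_nbhs_nbhs; split; [exact: chart_img_open|exists p].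
move=> /nbhs_ballP[r /= r0 rP].
(* The bump lives on the closed ball of half the radius, which is compact and inside [V]. *)
have r2 : 0 < r / 2 by rewrite divr_gt0.
have [b [sb b0 bp bK]] := Csmooth_bump (cmap c p) r2.
exists r, b; split=> //.
- by move=> x xr; apply: rP; rewrite -ball_normE /= distrC.
- by move=> k; apply: Ck_sub (sb k).
- exists [set x | `|x - cmap c p| <= r / 2]; split; first exact: compact_normball.
    by move=> x /= /le_lt_trans; apply; rewrite ltr_pdivrMr// mulr_natr mulr2n ltrDl.
  by move=> x nK; apply/eqP; apply: contra_notT nK => /bK.
Qed.

(** The closed set [C] between the nonvanishing set of [chi] and [U] is recorded because it makes
    [chi] times a local object extend smoothly by zero. *)
Lemma bump_exists U p : open U -> U p -> exists (chi : smoothfun M) (C : set M),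
  [/\ chi p != 0, closed C, C `<=` U & forall q, chi q != 0 -> C q].
Proof.
move=> oU Up; have [c ac cp] := atlas_cover p.
have [r [b [r0 VU sb bp [K [cK KV bK]]]]] := chart_bump ac oU Up cp.
set V := [set x | _] in VU sb KV.
have oV : open V by exact: open_normball.
have Vc : V `<=` cmap c @` cdom c by move=> x /VU[q [Uq cq] <-]; exists q.
have s : chart_ext c V b \in smoothb.
  by apply/smoothbP; apply: (@chart_ext_smooth _ _ _ c V K) => // x _; exact: bK.
have Vp : V (cmap c p) by rewrite /V /= subrr normr0.
exists (SmoothFun _ s), (cinv c @` K); split=> /=.
- by rewrite chart_extE// gt_eqF.
- by apply: closed_chart_img => // x /KV /Vc.
- by move=> _ [x Kx <-]; have [q [Uq cq] <-] := VU _ (KV _ Kx); rewrite cmapK ?inE.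
- move=> q; have [[cq Vq]|n'] := pselect (cdom c q /\ V (cmap c q)).
    rewrite chart_extE// => bq; exists (cmap c q); last by rewrite cmapK ?inE.
    by apply: contrapT => /bK E; rewrite E eqxx in bq.
  by rewrite chart_ext_out// eqxx.
Qed.

Lemma vfield_cutoff U (e : M -> smoothfun M -> R) (chi : smoothfun M) (C : set M) :
  open U -> closed C -> C `<=` U -> (forall q, chi q != 0 -> C q) ->
  smooth_vfield_on U e ->
  exists X : vfield M,
    (forall q, U q -> X q = chi q *: e q) /\ (forall q, ~ U q -> X q = 0).
Proof.
move=> oU cC CU chiC [te se].
pose X q : smoothfun M -> R := if `[< U q >] then chi q *: e q else 0.
have XU q : U q -> X q = chi q *: e q by rewrite /X; case: asboolP.
have XN q : ~ U q -> X q = 0 by rewrite /X; case: asboolP.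
suff s : X \in vfieldb by exists (VField X s).
apply/vfieldbP; split=> [q _|f].
  have [Uq|nU] := pselect (U q).
    rewrite XU//; have := tangent_comb (chi q) 0 (te q Uq) (te q Uq).
    by congr (tangent q _); apply/funext => f; rewrite mul0r addr0.
  by rewrite XN//; split=> [a f g|f g]; rewrite /= !mulr0 addr0.
apply: smooth_on_local => q _; have [Cq|nC] := pselect (C q).
  exists U; first exact: CU.
  apply: (@smooth_on_eq _ _ _ _ (sf_fun chi * (fun q => e q f))) => //.
    by move=> z Uz; rewrite XU.
  apply: smooth_onM => //; apply: smooth_on_sub (subsetT _) _.
  exact/smoothbP/sf_smooth.
exists (~` C) => //.
apply: (@smooth_on_eq _ _ _ _ (cst 0)); first exact: closed_openC.
  move=> z nCz; have [Uz|nU] := pselect (U z); last by rewrite XN.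
  rewrite XU//= (_ : chi z = 0) ?scale0r//.
  by apply/eqP; apply: contra_notT nCz => /chiC.
exact: smooth_on_cst.
Qed.

End Bumps.

(** * Frames *)

Section Frames.
Context {R : realType} {n : nat} {M : manifold R n}.
Implicit Types (U W : set M) (c : chart R n M) (p q : M) (f : smoothfun M).

Lemma sf_sumE (I : Type) (r : seq I) (F : I -> smoothfun M) p :
  (\sum_(i <- r) F i) p = \sum_(i <- r) F i p.
Proof. exact: (big_morph (fun f : smoothfun M => f p)). Qed.

Lemma vf_sumE (I : Type) (r : seq I) (F : I -> vfield M) p :
  (\sum_(i <- r) F i) p = \sum_(i <- r) F i p.
Proof. exact: (big_morph (fun X : vfield M => X p)). Qed.

Lemma tangentD p v (f g : smoothfun M) : tangent p v -> v (f + g) = v f + v g.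
Proof. by move=> [vl _]; have := vl 1 f g; rewrite scale1r mul1r. Qed.

Lemma tangent_sum p v (I : Type) (r : seq I) (F : I -> smoothfun M) :
  tangent p v -> v (\sum_(i <- r) F i) = \sum_(i <- r) v (F i).
Proof.
move=> tv; apply: (big_morph v) => [f g|]; first exact: tangentD tv.
by apply: (morphD0 (f := v)) => f g; exact: tangentD tv.
Qed.

Lemma tangent_lincomb p (I : Type) (r : seq I) (a : I -> R) (v : I -> smoothfun M -> R) :
  (forall i, tangent p (v i)) -> tangent p (\sum_(i <- r) a i *: v i).
Proof.
move=> tv; elim: r => [|i r IH].
  by rewrite big_nil; split=> [b f g|f g] /=; rewrite !mulr0 addr0.
rewrite big_cons; have := tangent_comb (a i) 1 (tv i) IH.
by congr (tangent p _); apply/funext => f; rewrite mul1r.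
Qed.

Lemma lincombE (I : Type) (r : seq I) (a : I -> R) (v : I -> smoothfun M -> R) f :
  (\sum_(i <- r) a i *: v i) f = \sum_(i <- r) a i * v i f.
Proof. exact: (big_morph (fun w : smoothfun M -> R => w f)). Qed.

Definition coord_vfield c (i : 'I_n) : M -> smoothfun M -> R :=
  fun q f => 'D_(delta_mx 0 i) (f \o cinv c) (cmap c q).

Lemma smooth_coord_vfield c i : atlas c -> smooth_vfield_on (cdom c) (coord_vfield c i).
Proof.
move=> ac; split=> [q cq|f].
  have d (f : smoothfun M) : derivable (f \o cinv c) (cmap c q) (delta_mx 0 i).
    by apply: Csmooth_derivable (Csmooth_smoothfun f ac) _; exists q.
  split=> [a f g|f g]; rewrite /coord_vfield.
    have -> : (a *: f + g) \o cinv c = a *: (f \o cinv c) + (g \o cinv c) by [].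
    by rewrite deriveD ?deriveZ//; exact: derivableZ.
  have -> : (f * g) \o cinv c = (f \o cinv c) * (g \o cinv c) by [].
  by rewrite deriveM//= cmapK ?inE.
apply: (@smooth_on_chart _ _ _ c) => //; first exact: cdom_open.
move=> k; apply: (@Ck_eq _ _ _ _ ('D_(delta_mx 0 i) (f \o cinv c))).
- exact: cimg_open.
- by move=> _ [q cq <-]; rewrite /= /coord_vfield cmapK ?inE.
- exact: Csmooth_derive (Csmooth_smoothfun f ac) k.
Qed.

(** Hadamard's lemma expresses [f] near [q] through the centred coordinates. These and the Hadamard
    factors are only local, so each is multiplied by the bump [b] and extended by zero; a derivation
    [v] then has coefficients [v (xi i) / b a]. Independence follows by evaluating on the functions
    [xi j]. *)
Lemma coord_basis c q : atlas c -> cdom c q ->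
  is_basis (tangent q) (fun i => coord_vfield c i q).
Proof.
move=> ac cq.
have [r [b [r0 VU sb bq [K [cK KV bK]]]]] := chart_bump ac openT Logic.I cq.
set a := cmap c q in r0 VU sb bq KV.
set V := [set x | _] in VU sb KV.
have oV : open V by exact: open_normball.
have Vc : V `<=` cmap c @` cdom c by move=> x /VU[z [_ cz] <-]; exists z.
have Va : V a by rewrite /V /= subrr normr0.
have ext h : Csmooth V h -> exists f : smoothfun M,
    (forall z, cdom c z -> V (cmap c z) -> f z = b (cmap c z) * h (cmap c z)) /\
    (forall z, ~ (cdom c z /\ V (cmap c z)) -> f z = 0).
  move=> sh.
  have s : chart_ext c V (b * h) \in smoothb.
    apply/smoothbP; apply: (@chart_ext_smooth _ _ _ c V K) => //.
      by move=> k; exact: Ck_mul (sb k) (sh k).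
    by move=> x _ /bK; rewrite mulrfctE => ->; rewrite mul0r.
  exists (SmoothFun _ s); split=> z /=; first by move=> cz Vz; rewrite chart_extE.
  exact: chart_ext_out.
have sx i : Csmooth V (fun x : 'rV[R]_n => x 0 i - a 0 i).
  move=> k; apply: (@Ck_eq _ _ _ _ ((fun x : 'rV[R]_n => x 0 i) + cst (- a 0 i))) => //.
  by apply: Ck_add => //; [exact: Ck_coord|exact: Ck_cst].
have /choice[xi xiP] i := ext _ (sx i).
have [chi [chiV chiN]] : exists f : smoothfun M,
    (forall z, cdom c z -> V (cmap c z) -> f z = b (cmap c z)) /\
    (forall z, ~ (cdom c z /\ V (cmap c z)) -> f z = 0).
  have [f [fV fN]] := ext (cst 1) (fun k => Ck_cst k V 1).
  by exists f; split=> // z cz Vz; rewrite fV// mulr1.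
have b0 : b a != 0 by rewrite gt_eqF.
have xiq i : xi i q = 0.
  by have [-> //] := xiP i; rewrite subrr mulr0.
have span v f : tangent q v ->
    v f = \sum_i (v (xi i) / b a) * coord_vfield c i q f.
  move=> tv.
  have sF : Csmooth V (f \o cinv c).
    by move=> k; apply: Ck_sub (Csmooth_smoothfun f ac k) => x /Vc.
  have [g [sg ga gE]] := hadamard sF.
  have /choice[G GP] i := ext _ (sg i).
  (* Multiplying Hadamard's identity by [chi * chi] makes it an identity
     between globally defined functions, to which [v] applies. *)
  have E : chi * chi * f = f q *: (chi * chi) + \sum_i xi i * G i.
    apply/val_inj/funext => z /=.
    transitivity (f q * (chi z * chi z) + (\sum_i xi i * G i) z); last by [].
    transitivity (chi z * chi z * f z); first by [].
    rewrite sf_sumE.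
    have [[cz Vz]|n'] := pselect (cdom c z /\ V (cmap c z)).
      rewrite chiV//.
      have -> : f z = (f \o cinv c) (cmap c z) by rewrite /= cmapK ?inE.
      rewrite (gE _ Vz) /= cmapK ?inE// mulrDr mulrC; congr (_ + _).
      rewrite mulr_sumr; apply: eq_bigr => i _.
      transitivity (xi i z * G i z); last by [].
      have [-> // _] := xiP i; have [-> // _] := GP i; ring.
    rewrite chiN// !mul0r mulr0 add0r big1// => i _.
    transitivity (xi i z * G i z); first by [].
    by have [_ ->] := xiP i => //; rewrite mul0r.
  (* Applying [v] by the Leibniz rule, the term [f q * v (chi * chi)] occurs on both sides and
     cancels. Since [xi i] vanishes at [q], each product on the right contributes only
     [G i q * v (xi i)], and [G i q] is [b a] times the [i]-th partial derivative of [f]. *)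
  have [vl vM] := tv.
  have := congr1 v E; rewrite vM vl (tangent_sum _ _ tv).
  rewrite (_ : \sum_i v (xi i * G i) = \sum_i b a * coord_vfield c i q f * v (xi i)).
    rewrite [(chi * chi) q]/(chi q * chi q) chiV// => /eqP.
    rewrite addrC (inj_eq (addrI _)) => /eqP H.
    apply: (mulfI b0); apply: (mulfI b0); rewrite mulrA H.
    rewrite !mulr_sumr; apply: eq_bigr => i _.
    by rewrite [RHS]mulrC; field.
  apply: eq_bigr => i _; rewrite vM xiq mul0r add0r.
  have [-> // _] := GP i; by rewrite ga.
(* In the product rule the derivative of [b] is multiplied by a centred coordinate, which is zero at
   [a]. *)
have dxi i j : coord_vfield c i q (xi j) = b a * (i == j)%:R.
  rewrite /coord_vfield.
  have near_a : \forall x \near a, (xi j \o cinv c) x = (b * (fun x => x 0 j - a 0 j)) x.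
    have : \forall x \near a, V x by apply: open_nbhs_nbhs; split.
    apply: filterS => x Vx; have [z cz zx] := Vc x Vx.
    have [xiV _] := xiP j.
    by rewrite -zx /= cmapK ?inE// xiV// zx.
  rewrite (near_eq_derive _ near_a).
  rewrite deriveM; [|exact: Csmooth_derivable sb Va|exact: Csmooth_derivable (sx j) Va].
  rewrite subrr scale0r addr0 /GRing.scale /=; congr (_ * _).
  have : is_derive a (delta_mx 0 i) (fun x : 'rV[R]_n => x 0 j - a 0 j) (i == j)%:R.
    apply/is_derive_line0.
    rewrite (_ : (fun _ => _) = (fun s : R => s * (i == j)%:R)); last first.
      by apply/funext => s; rewrite !mxE eqxx addrK eq_sym.
    by apply: is_derive_eq; rewrite /GRing.scale /= mulr1 mulr0 add0r.
  by case.
split=> [x y|]; last first.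
  apply/seteqP; split=> [v tv|_ [x _ <-]]; last first.
    by apply: tangent_lincomb => i; have [+ _] := smooth_coord_vfield i ac; exact.
  exists (fun i => v (xi i) / b a) => //; apply/funext => f.
  by rewrite lincombE -span.
move=> E; apply/funext => j.
have sumE (z : 'I_n -> R) : (\sum_i z i *: coord_vfield c i q) (xi j) = z j * b a.
  rewrite lincombE (bigD1 j)//= dxi eqxx mulr1 big1 ?addr0// => i ij.
  by rewrite dxi (negbTE ij) !mulr0.
by apply: (mulIf b0); rewrite -!sumE E.
Qed.

(** Viewing the tangent bundle as a distribution of full rank makes extension of vectors and Riesz
    representation available for it too. The definition is transparent so that its fibre computes to
    [tangent]. *)
Definition tangent_distribution : Defs.distribution (M := M) n.
Proof.
apply: (@Distribution _ _ _ n (@tangent R n M)) => p.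
have [c ac cp] := atlas_cover p.
exists (cdom c), (coord_vfield c); split=> //; first exact: cdom_open.
- by move=> i; exact: smooth_coord_vfield.
- by move=> q cq; exact: coord_basis.
Defined.

Section Distribution.
Variables (k : nat) (E : Defs.distribution (M := M) k).

(** That fibres are linear subspaces is read off from the local frames; the next three lemmas are
    the cases of zero, one and two summands. *)
Lemma dfib_lincomb q (I : Type) (r : seq I) (a : I -> R) (v : I -> smoothfun M -> R) :
  (forall i, E q (v i)) -> E q (\sum_(i <- r) a i *: v i).
Proof.
have [U [e [oU Uq se /(_ q Uq)[_ ->]]]] := dfib_frame E q.
move=> Ev; have /choice[x vE] i : exists x : 'I_k -> R, \sum_j x j *: e j q = v i.
  by have [x _ <-] := Ev i; exists x.
exists (fun j => \sum_(i <- r) a i * x i j) => //.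
under [RHS]eq_bigr => i _ do rewrite -vE scaler_sumr.
rewrite exchange_big; apply: eq_bigr => j _; rewrite scaler_suml.
by apply: eq_bigr => i _; rewrite scalerA.
Qed.

Lemma dfib0 q : E q 0.
Proof.
have := @dfib_lincomb q 'I_0 [::] (fun=> 0) (fun=> 0).
by rewrite big_nil; apply; case.
Qed.

Lemma dfibZ q (a : R) v : E q v -> E q (a *: v).
Proof.
move=> Ev; have := @dfib_lincomb q unit [:: tt] (fun=> a) (fun=> v).
by rewrite big_seq1; apply.
Qed.

Lemma dfibD q v w : E q v -> E q w -> E q (v + w).
Proof.
move=> Ev Ew; have := @dfib_lincomb q bool [:: true; false] (fun=> 1)
  (fun b => if b then v else w).
by rewrite !big_cons big_nil !scale1r addr0; apply; case.
Qed.

Lemma dfib_tangent q v : E q v -> tangent q v.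
Proof.
have [U [e [oU Uq se /(_ q Uq)[_ ->]]]] := dfib_frame E q.
by move=> [x _ <-]; apply: tangent_lincomb => i; have [+ _] := se i; exact.
Qed.

(** A local frame multiplied by a bump function becomes global, and it remains a basis wherever the
    bump does not vanish. *)
Lemma global_frame p : exists (chi : smoothfun M) (s : 'I_k -> vfield M),
  [/\ chi p != 0, forall i, section E (s i) &
     forall q, chi q != 0 -> is_basis (E q) (fun i => s i q)].
Proof.
have [U [e [oU Up se eb]]] := dfib_frame E p.
have [chi [C [chip cC CU chiC]]] := bump_exists oU Up.
have /choice[s sP] i := vfield_cutoff oU cC CU chiC (se i).
exists chi, s; split=> // [i q|q chiq].
  have [sU sN] := sP i; have [Uq|nU] := pselect (U q); last by rewrite sN//; exact: dfib0.
  rewrite sU//; apply: dfibZ; have [_ ->] := eb q Uq.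
  exists (fun j => (j == i)%:R) => //.
  rewrite (bigD1 i)//= eqxx scale1r big1 ?addr0// => j /negbTE ->.
  by rewrite scale0r.
have Uq : U q by exact/CU/chiC.
have [inj ->] := eb q Uq.
have sE i : s i q = chi q *: e i q by have [-> //] := sP i.
have sumE (x : 'I_k -> R) : \sum_i x i *: s i q = \sum_i (x i * chi q) *: e i q.
  by apply: eq_bigr => i _; rewrite sE scalerA.
split=> [x y|].
  rewrite !sumE => /inj E'; apply/funext => i.
  by have := congr1 (fun h : 'I_k -> R => h i) E'; exact: mulIf.
apply/seteqP; split=> _ [x _ <-].
  exists (fun i => x i / chi q) => //; rewrite sumE; apply: eq_bigr => i _.
  by rewrite divfK.
by exists (fun i => x i * chi q) => //; rewrite sumE.
Qed.

Lemma section_through p v : E p v -> exists2 X : vfield M, section E X & X p = v.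
Proof.
have [chi [s [chip sE sb]]] := global_frame p.
have [_ ->] := sb p chip; move=> [x _ <-].
pose X q : smoothfun M -> R := \sum_i x i *: s i q.
have cx (i : 'I_k) : cst (x i) \in @smoothb R n M.
  by apply/smoothbP; exact: smooth_on_cst.
pose Y : vfield M := \sum_i (SmoothFun _ (cx i)) *: s i.
have YE q : Y q = \sum_i x i *: s i q.
  by rewrite /Y vf_sumE.
exists Y => // q; rewrite YE; apply: dfib_lincomb => i; exact: sE.
Qed.

End Distribution.
End Frames.

(** * Riesz representation *)

Section SmoothFunctionValues.
Context {R : realType} {n : nat} {M : manifold R n}.

(** A named evaluation carries the ring morphism structure, through which determinants of matrices
    of functions commute with evaluation. *)
Definition sf_eval (p : M) : smoothfun M -> R := fun f => f p.

HB.instance Definition _ p := GRing.isZmodMorphism.Build _ _ (sf_eval p)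
  (fun f h => erefl).
HB.instance Definition _ p := GRing.isMonoidMorphism.Build _ _ (sf_eval p)
  (conj erefl (fun f h => erefl)).

Lemma smoothfun_continuous (f : smoothfun M) : continuous (sf_fun f).
Proof.
move=> p; have [c ac cp] := atlas_cover p.
have E : {near p, (f \o cinv c) \o cmap c =1 f}.
  have : \forall q \near p, cdom c q by apply: open_nbhs_nbhs; split; [exact: cdom_open|].
  by apply: filterS => q cq /=; rewrite cmapK ?inE.
rewrite /continuous_at -[f p](nbhs_singleton E).
apply: cvg_trans (near_eq_cvg E) _.
apply: continuous_comp; first by apply: cmap_continuous; rewrite inE.
by apply: Csmooth_cont (Csmooth_smoothfun f ac) _; exists p.
Qed.

Lemma open_smoothfun_neq0 (f : smoothfun M) : open [set q | f q != 0].
Proof.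
have -> : [set q | f q != 0] = sf_fun f @^-1` [set x | x != 0] by [].
by apply: open_comp; [move=> x _; exact: smoothfun_continuous|exact: open_neq].
Qed.

Lemma smooth_on_inv (U : set M) (f : smoothfun M) : open U ->
  (forall q, U q -> f q != 0) -> smooth_on U (fun q => (f q)^-1).
Proof.
move=> oU f0 c ac k; apply: Ck_inv; first exact: chart_img_open.
  by move=> _ [q [Uq cq] <-] /=; rewrite cmapK ?inE//; exact: f0.
apply: Ck_sub (Csmooth_smoothfun f ac k) => _ [q [_ cq] <-].
by exists q.
Qed.

End SmoothFunctionValues.

Section Metric.
Context {R : realType} {n : nat} {M : manifold R n} (g : riemannian_metric M).
Implicit Types (X Y Z W : vfield M) (f : smoothfun M) (p q : M).

Lemma metric_appE X Y p : metric_app g X Y p = g p (X p) (Y p).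
Proof. by []. Qed.

Lemma metric_appC X Y : metric_app g X Y = metric_app g Y X.
Proof.
by apply/val_inj/funext => p; apply: mform_sym; exact: vf_tangent.
Qed.

Lemma metric_app_linear f X Y Z :
  metric_app g (f *: X + Y) Z = f * metric_app g X Z + metric_app g Y Z.
Proof.
by apply/val_inj/funext => p; apply: mform_linear; exact: vf_tangent.
Qed.

Lemma metric_appDl X Y Z :
  metric_app g (X + Y) Z = metric_app g X Z + metric_app g Y Z.
Proof. by have := metric_app_linear 1 X Y Z; rewrite scale1r mul1r. Qed.

Lemma metric_app0l Z : metric_app g 0 Z = 0.
Proof.
by apply: (morphD0 (f := fun X => metric_app g X Z)) => X Y; exact: metric_appDl.
Qed.

Lemma metric_appZl f X Z : metric_app g (f *: X) Z = f * metric_app g X Z.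
Proof. by have := metric_app_linear f X 0 Z; rewrite metric_app0l !addr0. Qed.

Lemma metric_appNl X Z : metric_app g (- X) Z = - metric_app g X Z.
Proof. by rewrite -scaleN1r metric_appZl mulN1r. Qed.

Lemma metric_appBl X Y Z :
  metric_app g (X - Y) Z = metric_app g X Z - metric_app g Y Z.
Proof. by rewrite metric_appDl metric_appNl. Qed.

Lemma metric_appDr X Y Z :
  metric_app g Z (X + Y) = metric_app g Z X + metric_app g Z Y.
Proof. by rewrite !(metric_appC Z) metric_appDl. Qed.

Lemma metric_appZr f X Z : metric_app g Z (f *: X) = f * metric_app g Z X.
Proof. by rewrite !(metric_appC Z) metric_appZl. Qed.

Lemma metric_app0r Z : metric_app g Z 0 = 0.
Proof. by rewrite metric_appC metric_app0l. Qed.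

Lemma metric_appNr X Z : metric_app g Z (- X) = - metric_app g Z X.
Proof. by rewrite !(metric_appC Z) metric_appNl. Qed.

Lemma metric_appBr X Y Z :
  metric_app g Z (X - Y) = metric_app g Z X - metric_app g Z Y.
Proof. by rewrite !(metric_appC Z) metric_appBl. Qed.

Lemma metric_app_suml (I : Type) (r : seq I) (F : I -> vfield M) Z :
  metric_app g (\sum_(i <- r) F i) Z = \sum_(i <- r) metric_app g (F i) Z.
Proof.
apply: (big_morph (metric_app g ^~ Z)) => [X Y|]; first exact: metric_appDl.
exact: metric_app0l.
Qed.

Lemma mform_eq0 p v : tangent p v -> g p v v = 0 -> v = 0.
Proof.
move=> tv E; apply/eqP; apply/negP => /negP v0.
by have := mform_pos g tv v0 : 0 < g p v v; rewrite E ltxx.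
Qed.

Lemma metric_app_eq0 W : metric_app g W W = 0 -> W = 0.
Proof.
move=> E; apply/val_inj/funext => p; apply: (@mform_eq0 p); first exact: vf_tangent.
by have := congr1 (fun f : smoothfun M => f p) E.
Qed.

Lemma mform_lincomb p (I : Type) (r : seq I) (a : I -> R) (v : I -> smoothfun M -> R) w :
  (forall i, tangent p (v i)) -> tangent p w ->
  g p (\sum_(i <- r) a i *: v i) w = \sum_(i <- r) a i * g p (v i) w.
Proof.
move=> tv tw; elim: r => [|i r IH].
  have t0 : tangent p (0 : smoothfun M -> R).
    by have := tangent_lincomb [::] a tv; rewrite big_nil.
  rewrite !big_nil; have := mform_linear g 1 t0 t0 tw.
  rewrite scale1r addr0 mul1r => /eqP; rewrite -subr_eq subrr eq_sym => /eqP; exact.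
rewrite !big_cons -IH; apply: mform_linear => //; exact: tangent_lincomb.
Qed.

Variables (k : nat) (E : Defs.distribution (M := M) k).

Section LocalRiesz.
Variables (s : 'I_k -> vfield M).

Let G : 'M[smoothfun M]_k := \matrix_(i, j) metric_app g (s i) (s j).

Let G_sym : G^T = G.
Proof. by apply/matrixP => i j; rewrite !mxE metric_appC. Qed.

Let adj_sym i j : (\adj G) i j = (\adj G) j i.
Proof. by rewrite -[in LHS]G_sym -trmx_adj mxE. Qed.

(** A vector in the kernel of the Gram matrix at [p] gives a combination of the frame of zero
    length; by positivity it is zero, and by independence so are its coefficients. *)
Lemma det_gram_neq0 p : is_basis (E p) (fun i => s i p) -> (\det G) p != 0.
Proof.
move=> [inj EP].
have -> : (\det G) p = \det (map_mx (sf_eval p) G) by rewrite det_map_mx.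
apply/negP => /det0P[v v0 vG].
have ts i : tangent p (s i p) by exact: vf_tangent.
have V0 : \sum_i v 0 i *: s i p = 0.
  apply: (@mform_eq0 p); first exact: tangent_lincomb.
  rewrite mform_lincomb//; last exact: tangent_lincomb.
  rewrite big1// => i _; rewrite mform_sym//; last exact: tangent_lincomb.
  rewrite mform_lincomb//.
  have -> : \sum_j v 0 j * g p (s j p) (s i p) = (v *m map_mx (sf_eval p) G) 0 i.
    by rewrite mxE; apply: eq_bigr => j _; rewrite !mxE.
  by rewrite vG mxE mulr0.
case/eqP: v0; apply/rowP => i; rewrite mxE.
have /inj/(congr1 (fun h : 'I_k -> R => h i)) // :
    (fun a : 'I_k -> R => \sum_i a i *: s i p) (fun i => v 0 i) =
    (fun a : 'I_k -> R => \sum_i a i *: s i p) (fun=> 0).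
by rewrite V0 big1// => j _; rewrite scale0r.
Qed.

Variable (chi : smoothfun M).
Hypothesis s_sec : forall i, section E (s i).
Hypothesis s_basis : forall q, chi q != 0 -> is_basis (E q) (fun i => s i q).

(* The factor [chi] is there because [s] is a frame only where [chi] is nonzero. *)
Lemma gram_expand Z : section E Z ->
  chi * \det G *: Z =
  \sum_i (\sum_j chi * (\adj G) i j * metric_app g Z (s j)) *: s i.
Proof.
move=> EZ.
(* The difference of the two sides before multiplication by [chi]. It is orthogonal to every [s l]
   because the Gram matrix times its adjugate is the determinant; where [chi] is nonzero it is also
   a combination of the [s i], so it vanishes there. *)
pose W := \det G *: Z - \sum_i (\sum_j (\adj G) i j * metric_app g Z (s j)) *: s i.
have Ws l : metric_app g W (s l) = 0.
  rewrite /W metric_appBl metric_appZl metric_app_suml; apply/eqP.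
  rewrite subr_eq0; apply/eqP.
  under [RHS]eq_bigr => i _ do rewrite metric_appZl mulr_suml.
  rewrite exchange_big /=.
  transitivity (\sum_j (G *m \adj G) l j * metric_app g Z (s j)).
    rewrite mul_mx_adj (bigD1 l)//= big1 => [|j /negbTE jl]; rewrite !mxE.
      by rewrite eqxx mulr1n addr0.
    by rewrite eq_sym jl mulr0n mul0r.
  apply: eq_bigr => j _; rewrite mxE mulr_suml; apply: eq_bigr => i _.
  by rewrite !mxE (metric_appC (s l)) -mulrA mulrC.
have chiW : chi *: W = 0.
  apply/val_inj/funext => q.
  have [chiq|chiq] := eqVneq (chi q) 0.
    by apply/funext => f; rewrite /= chiq mul0r.
  suff W0 : W q = 0.
    apply/funext => f; transitivity (chi q * W q f); first by [].
    rewrite W0; exact: mulr0.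
  have EW : E q (W q).
    have -> : W q = (\det G) q *: Z q +
        \sum_i (- (\sum_j (\adj G) i j * metric_app g Z (s j)) q) *: s i q.
      rewrite /W -[LHS]/((\det G) q *: Z q - (\sum_i _ *: s i) q); congr (_ + _).
      rewrite vf_sumE.
      rewrite -sumrN; apply: eq_bigr => i _; by rewrite scaleNr.
    apply: dfibD; first by apply: dfibZ; exact: EZ.
    by apply: dfib_lincomb => i; exact: s_sec.
  have tW := vf_tangent W q.
  have [_ EP] := s_basis chiq; move: EW; rewrite EP => -[a _ aW].
  apply: (mform_eq0 tW); rewrite -{1}aW mform_lincomb//.
    2: by move=> i; exact: vf_tangent.
  rewrite big1// => i _.
  have := congr1 (fun f : smoothfun M => f q) (Ws i); rewrite metric_appE.
  rewrite mform_sym//; last exact: vf_tangent.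
  by move=> ->; rewrite mulr0.
move/eqP: chiW; rewrite /W scalerBr subr_eq0 scalerA => /eqP ->.
rewrite scaler_sumr; apply: eq_bigr => i _; rewrite scalerA mulr_sumr.
by congr (_ *: _); apply: eq_bigr => j _; rewrite mulrA.
Qed.

Variable lam : vfield M -> smoothfun M.
Hypothesis lam_linear : forall f X Y, lam (f *: X + Y) = f * lam X + lam Y.

Let lamD X Y : lam (X + Y) = lam X + lam Y.
Proof. by have := lam_linear 1 X Y; rewrite scale1r mul1r. Qed.

Let lam0 : lam 0 = 0.
Proof.
exact: morphD0 lamD.
Qed.

Let lamZ f X : lam (f *: X) = f * lam X.
Proof. by have := lam_linear f X 0; rewrite lam0 !addr0. Qed.

(** Cramer's rule with the denominators cleared: [lam] is applied to the expansion [gram_expand],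
    and the symmetry of the adjugate identifies the result with the pairing. *)
Lemma local_riesz : exists2 V, section E V & forall Z, section E Z ->
  metric_app g V Z = chi * \det G * lam Z.
Proof.
exists (\sum_i (\sum_j chi * (\adj G) i j * lam (s j)) *: s i).
  move=> q; rewrite vf_sumE.
  by apply: dfib_lincomb => i; exact: s_sec.
move=> Z EZ; rewrite -lamZ gram_expand// (big_morph lam lamD lam0).
under [RHS]eq_bigr => i _ do rewrite lamZ mulr_suml.
rewrite exchange_big /= metric_app_suml; apply: eq_bigr => i _.
rewrite metric_appZl mulr_suml; apply: eq_bigr => j _.
by rewrite adj_sym (metric_appC Z) mulrAC.
Qed.

End LocalRiesz.

(** The local solutions divided by their factors agree wherever both factors are nonzero, by
    positive definiteness, so they glue. *)
Lemma riesz (lam : vfield M -> smoothfun M) :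
  (forall f X Y, lam (f *: X + Y) = f * lam X + lam Y) ->
  exists2 V, section E V & forall Z, section E Z -> metric_app g V Z = lam Z.
Proof.
move=> lam_linear.
have /choice[D DP] p : exists dV : smoothfun M * vfield M,
    [/\ dV.1 p != 0, section E dV.2 &
        forall Z, section E Z -> metric_app g dV.2 Z = dV.1 * lam Z].
  have [chi [s [chip sE sb]]] := global_frame E p.
  have [V EV VP] := local_riesz sE sb lam_linear.
  exists (chi * \det (\matrix_(i, j) metric_app g (s i) (s j)), V); split=> //=.
  by apply: mulf_neq0 => //; apply: det_gram_neq0; exact: sb.
pose u p q : smoothfun M -> R := ((D p).1 q)^-1 *: (D p).2 q.
have uE p q : E q (u p q) by apply: dfibZ; have [_ + _] := DP p; exact.
have uZ p q Z : (D p).1 q != 0 -> section E Z -> g q (u p q) (Z q) = lam Z q.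
  move=> dq EZ; have [_ _ /(_ Z EZ) VP] := DP p.
  have := congr1 (fun f : smoothfun M => f q) VP.
  rewrite metric_appE => {}VP.
  have := @mform_lincomb q _ [:: tt] (fun=> ((D p).1 q)^-1) (fun=> (D p).2 q) (Z q).
  rewrite !big_seq1 => ->; [|by move=> _; exact: vf_tangent|exact: vf_tangent].
  rewrite VP; transitivity (((D p).1 q)^-1 * ((D p).1 q * lam Z q)); first by [].
  by rewrite mulKf.
have u_uniq p p' q : (D p).1 q != 0 -> (D p').1 q != 0 -> u p q = u p' q.
  move=> dq dq'; apply/eqP; rewrite -subr_eq0; apply/eqP.
  have Ed : E q (u p q - u p' q).
    by apply: dfibD => //; rewrite -scaleN1r; apply: dfibZ.
  have [Z EZ Zq] := section_through Ed.
  apply: (@mform_eq0 q); first exact: dfib_tangent Ed.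
  have tu p1 := dfib_tangent (uE p1 q).
  have := mform_linear g (-1) (tu p') (tu p) (vf_tangent Z q).
  by rewrite !uZ// scaleN1r Zq addrC => ->; rewrite mulN1r addNr.
(* Each point uses its own local solution. Near [p] this coincides with the single solution attached
   to [p], which is smooth where its factor is nonzero. *)
have sV : (fun q => u q q) \in vfieldb.
  apply/vfieldbP; split=> [q _|f]; first exact: dfib_tangent (uE q q).
  apply: smooth_on_local => p _.
  have oW := open_smoothfun_neq0 (D p).1.
  exists [set q | (D p).1 q != 0]; first by have [] := DP p.
  pose d q := ((D p).1 q)^-1.
  apply: (@smooth_on_eq _ _ _ _ (d * (fun q => (D p).2 q f))) => //.
    by move=> q dq; rewrite -(u_uniq p q)//; have [] := DP q.
  apply: smooth_onM => //; first exact: smooth_on_inv.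
  apply: smooth_on_sub (subsetT _) _.
  exact/smoothbP/vf_app_subproof.
exists (VField _ sV) => [q|Z EZ]; first exact: uE.
by apply/val_inj/funext => q; apply: uZ => //; have [] := DP q.
Qed.

End Metric.

(** * The Koszul formula *)

Section VectorFieldCalculus.
Context {R : realType} {n : nat} {M : manifold R n}.
Implicit Types (X Y Z W : vfield M) (f h : smoothfun M).

Lemma vf_appD X f h : vf_app X (f + h) = vf_app X f + vf_app X h.
Proof. by apply/val_inj/funext => p; exact: (tangentD _ _ (vf_tangent X p)). Qed.

Lemma vf_appM X f h : vf_app X (f * h) = f * vf_app X h + h * vf_app X f.
Proof. by apply/val_inj/funext => p; have [_] := vf_tangent X p; exact. Qed.

Lemma vf_app0 X : vf_app X 0 = 0.
Proof. by apply: morphD0 => f h; exact: vf_appD. Qed.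

Lemma vf_appDl X Y f : vf_app (X + Y) f = vf_app X f + vf_app Y f.
Proof. exact/val_inj. Qed.

Lemma vf_appZl h X f : vf_app (h *: X) f = h * vf_app X f.
Proof. exact/val_inj. Qed.

Lemma vf_app0l f : vf_app (0 : vfield M) f = 0.
Proof. exact/val_inj. Qed.

Lemma lieDl X Y Z : lie (X + Y) Z = lie X Z + lie Y Z.
Proof.
apply/val_inj/funext => p; apply/funext => h /=.
rewrite vf_appDl (tangentD _ _ (vf_tangent Z p)).
transitivity (X p (vf_app Z h) + Y p (vf_app Z h) -
  (Z p (vf_app X h) + Z p (vf_app Y h))) => //.
transitivity (X p (vf_app Z h) - Z p (vf_app X h) +
  (Y p (vf_app Z h) - Z p (vf_app Y h))) => //.
ring.
Qed.

Lemma lieZl f X Z : lie (f *: X) Z = f *: lie X Z - vf_app Z f *: X.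
Proof.
apply/val_inj/funext => p; apply/funext => h /=.
have [_ ZM] := vf_tangent Z p.
rewrite vf_appZl ZM.
transitivity (f p * X p (vf_app Z h) - (f p * Z p (vf_app X h) + X p h * Z p f)) => //.
transitivity (f p * (X p (vf_app Z h) - Z p (vf_app X h)) - Z p f * X p h) => //.
ring.
Qed.

Lemma lieC X Y : lie X Y = - lie Y X.
Proof.
by apply/val_inj/funext => p; apply/funext => h; rewrite /= opprB.
Qed.

Lemma lieDr X Y Z : lie Z (X + Y) = lie Z X + lie Z Y.
Proof. by rewrite lieC lieDl opprD -!lieC. Qed.

Lemma lieZr f X Z : lie Z (f *: X) = f *: lie Z X + vf_app Z f *: X.
Proof. by rewrite lieC lieZl opprB addrC -scalerN -lieC. Qed.

Lemma lie0l Z : lie 0 Z = 0.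
Proof. by apply: (morphD0 (f := fun X => lie X Z)) => X Y; exact: lieDl. Qed.

Lemma lie0r Z : lie Z 0 = 0.
Proof. by rewrite lieC lie0l oppr0. Qed.

End VectorFieldCalculus.

(** * The Koszul expression of a self-adjoint projection *)

Section Koszul.
Context {R : realType} {n : nat} {M : manifold R n} (g : riemannian_metric M).
Implicit Types (X Y Z W : vfield M) (f h : smoothfun M).
Variable P : vfield M -> vfield M.
Hypothesis P_linear : forall f X Y, P (f *: X + Y) = f *: P X + P Y.
Hypothesis P_adj : forall X Y, metric_app g (P X) Y = metric_app g X (P Y).
Hypothesis P_idem : forall X, P (P X) = P X.

Local Notation G := (metric_app g).

(** For [P] the identity this is the classical Koszul expression of the Levi-Civita connection. When
    [P X = 0] only the first three terms survive. *)
Definition koszul X Y Z : smoothfun M :=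
  vf_app X (G (P Y) (P Z)) + G (lie X (P Y)) (P Z) - G (lie X (P Z)) (P Y) +
  vf_app (P Y) (G (P X) (P Z)) - vf_app (P Z) (G (P X) (P Y)) - G (lie (P Y) (P Z)) (P X).

Let P_pair X Y : G X (P Y) = G (P X) (P Y).
Proof. by rewrite P_adj P_idem. Qed.

(** The brackets produce derivatives of [f] times [G X (P Y)] and [G X (P Z)]. They cancel the other
    derivatives of [f] because [P] is self-adjoint and idempotent, so that [X] may be replaced by
    [P X] there. *)
Lemma koszul_linear_l f X X' Y Z :
  koszul (f *: X + X') Y Z = f * koszul X Y Z + koszul X' Y Z.
Proof.
rewrite /koszul !P_linear !lieDl !lieZl !vf_appDl !vf_appZl.
rewrite !metric_appDl !metric_appDr !metric_appNl !metric_appZl !metric_appZr.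
rewrite !vf_appD !vf_appM (P_pair X Y) (P_pair X Z).
ring.
Qed.

Lemma koszul_linear_r f X Y Z Z' :
  koszul X Y (f *: Z + Z') = f * koszul X Y Z + koszul X Y Z'.
Proof.
rewrite /koszul !P_linear !lieDr !lieZr !vf_appDl !vf_appZl.
rewrite !metric_appDl !metric_appDr !metric_appZl !metric_appZr.
rewrite !vf_appD !vf_appM (metric_appC g (P Z) (P Y)) (metric_appC g (P Z) (P X)).
ring.
Qed.

(** The derivative of [f] along [X] survives twice, from the first term and from the bracket of [X]
    and [P Y]; its derivatives along [P Z] cancel. *)
Lemma koszul_leibniz f X Y Y' Z :
  koszul X (f *: Y + Y') Z =
  f * koszul X Y Z + koszul X Y' Z + (vf_app X f * G (P Y) (P Z)) *+ 2.
Proof.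
rewrite /koszul !P_linear !lieDr !lieDl !lieZr !lieZl !vf_appDl !vf_appZl.
rewrite !metric_appDl !metric_appDr !metric_appNl !metric_appZl !metric_appZr.
rewrite !vf_appD !vf_appM (metric_appC g (P Y) (P X)).
ring.
Qed.

(** Metricity in terms of the Koszul expression: all but the first term are skew in [Y] and [Z]. *)
Lemma koszul_skew X Y Z :
  koszul X Y Z + koszul X Z Y = vf_app X (G (P Y) (P Z)) *+ 2.
Proof.
rewrite /koszul (metric_appC g (P Z) (P Y)) (lieC (P Z) (P Y)) metric_appNl.
ring.
Qed.

Lemma koszul_eq0l X Y Z : P Y = 0 -> koszul X Y Z = 0.
Proof.
move=> PY; rewrite /koszul PY !lie0r !lie0l !vf_app0l.
by rewrite !(metric_app0l, metric_app0r) !vf_app0 !(addr0, subr0).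
Qed.

Lemma koszul_eq0r X Y Z : P Z = 0 -> koszul X Y Z = 0.
Proof.
move=> PZ; rewrite /koszul PZ !lie0r !vf_app0l.
by rewrite !(metric_app0l, metric_app0r) !vf_app0 !(addr0, subr0).
Qed.

Lemma koszul_proj X Y Z : koszul X (P Y) (P Z) = koszul X Y Z.
Proof. by rewrite /koszul !P_idem. Qed.

Lemma koszul_torsion X Y Z : P X = X -> P Y = Y -> P Z = Z ->
  koszul X Y Z - koszul Y X Z = G (lie X Y) Z *+ 2.
Proof.
move=> PX PY PZ; rewrite /koszul PX PY PZ (lieC Y X) metric_appNl (metric_appC g Y X).
ring.
Qed.

(** Both sides equal the Lie derivative of [g] along [Z], evaluated on [X] and [Y]. *)
Lemma koszul_symmetric X Y Z : P X = X -> P Y = Y -> P Z = 0 ->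
  koszul Z X Y - G (lie Z X) Y *+ 2 = koszul Z Y X - G (lie Z Y) X *+ 2.
Proof.
move=> PX PY PZ; rewrite /koszul PX PY PZ !metric_app0l !metric_app0r !vf_app0.
rewrite (metric_appC g Y X); ring.
Qed.

Section Uniqueness.
Variable nabla : vfield M -> vfield M -> vfield M.
Hypothesis nabla_linear : linear_connection nabla.
Hypothesis nabla_metr : forall Z X Y, nabla_metric nabla g Z X Y = 0.
Hypothesis nabla_ker : forall X Y, P Y = 0 -> P (nabla X Y) = 0.
Hypothesis torsion_P : forall X Y Z, P X = X -> P Y = Y -> P Z = Z ->
  G (torsion nabla X Y) Z = 0.
Hypothesis torsion_sym : forall X Y Z, P X = X -> P Y = Y -> P Z = 0 ->
  G (torsion nabla Z X) Y = G X (torsion nabla Z Y).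

Let metr X Y Z : vf_app X (G Y Z) = G (nabla X Y) Z + G (nabla X Z) Y.
Proof.
have /eqP := nabla_metr X Y Z; rewrite /nabla_metric.
by rewrite -addrA -opprD subr_eq0 => /eqP ->; rewrite (metric_appC g Y).
Qed.

(** Both sides are additive in [X], so it is enough to treat [X] in the image and in the kernel of
    [P]. In the image, the classical argument from metricity and vanishing torsion applies. *)
Lemma koszul_unique X Y Z : P Y = Y -> P Z = Z ->
  G (nabla X Y) Z *+ 2 = koszul X Y Z.
Proof.
move=> PY PZ; have [nl nD _] := nabla_linear.
have onP W : P W = W -> G (nabla W Y) Z *+ 2 = koszul W Y Z.
  move=> PW; rewrite /koszul PW PY PZ !metr.
  have tor A B C : P A = A -> P B = B -> P C = C ->
      G (lie A B) C = G (nabla A B) C - G (nabla B A) C.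
    move=> PA PB PC; have := torsion_P PA PB PC.
    by rewrite /torsion !metric_appBl => /eqP; rewrite subr_eq0 => /eqP.
  by rewrite !tor//; ring.
have onK W : P W = 0 -> G (nabla W Y) Z *+ 2 = koszul W Y Z.
  move=> PW; rewrite /koszul PW PY PZ !metric_app0l !metric_app0r !vf_app0 !metr.
  have := torsion_sym PY PZ PW.
  rewrite (metric_appC g Y) /torsion !metric_appBl.
  (* The connection preserves the kernel of [P], so the torsion of [W] and [Y] pairs with the image
     of [P] as the covariant derivative minus the bracket. Its symmetry and metricity along [W]
     determine the pairing. *)
  have z A B : P B = B -> G (nabla A W) B = 0.
    by move=> PB; rewrite -PB -P_adj nabla_ker// metric_app0l.
  rewrite !z// !subr0 => E.
  have -> : G (lie W Y) Z = G (nabla W Y) Z - (G (nabla W Z) Y - G (lie W Z) Y).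
    by rewrite -E; ring.
  ring.
have P0 : P (X - P X) = 0.
  by rewrite addrC -scaleN1r P_linear P_idem scaleN1r addNr.
have -> : X = 1 *: P X + (X - P X) by rewrite scale1r addrC subrK.
rewrite nl koszul_linear_l metric_appDl metric_appZl !mul1r mulrnDl.
by rewrite onP// onK.
Qed.

End Uniqueness.
End Koszul.

(** * Orthogonal projections onto a distribution and onto its complement *)

Section Decomposition.
Context {R : realType} {n : nat} {M : manifold R n} (g : riemannian_metric M).
Variables (k : nat) (E : Defs.distribution (M := M) k).
Implicit Types (X Y Z W V : vfield M) (f h : smoothfun M).

Local Notation G := (metric_app g).
Local Notation Ep := (orth g E).

Lemma metric_app_inj V W : (forall Z, G V Z = G W Z) -> V = W.
Proof.
move=> VW; apply/eqP; rewrite -subr_eq0; apply/eqP.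
by apply: (metric_app_eq0 (g := g)); rewrite metric_appBl VW subrr.
Qed.

Lemma orth_sectionP X : section Ep X <-> forall Z, section E Z -> G X Z = 0.
Proof.
split=> [oX Z EZ|oX q].
  by apply/val_inj/funext => q; have [_ /(_ _ (EZ q))] := oX q.
split=> [|w Ew]; first exact: vf_tangent.
have [Z EZ <-] := section_through Ew.
by have := congr1 (fun f : smoothfun M => f q) (oX Z EZ).
Qed.

Lemma section_eq X Y : section E X -> section E Y ->
  (forall Z, section E Z -> G X Z = G Y Z) -> X = Y.
Proof.
move=> EX EY XY; have EXY : section E (X - Y).
  move=> q; apply: dfibD (EX q) _.
  by rewrite -[X in E q X]scaleN1r; exact: dfibZ.
apply/eqP; rewrite -subr_eq0; apply/eqP; apply: (metric_app_eq0 (g := g)).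
by rewrite metric_appBl XY// subrr.
Qed.

(** The projection of [X] is the representative in [E] of the functional pairing with [X]; its
    smoothness comes from Riesz representation. *)
Lemma exists_orth_proj : exists P : vfield M -> vfield M,
  (forall X, section E (P X)) /\ (forall X Z, section E Z -> G (P X) Z = G X Z).
Proof.
have /choice[P PP] X : exists V, section E V /\ forall Z, section E Z -> G V Z = G X Z.
  have [|V EV VZ] := @riesz _ _ _ g _ E (G X); last by exists V.
  by move=> f Y Z; rewrite metric_appDr metric_appZr.
by exists P; split=> X; have [] := PP X.
Qed.

Variable P : vfield M -> vfield M.
Hypothesis PE : forall X, section E (P X).
Hypothesis PG : forall X Z, section E Z -> G (P X) Z = G X Z.

Let Q X := X - P X.

Lemma proj_adj X Y : G (P X) Y = G X (P Y).
Proof. by rewrite -(PG X (PE Y)) metric_appC [RHS]metric_appC PG. Qed.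

Lemma proj_section X : section E X <-> P X = X.
Proof.
split=> [EX|<-]; last exact: PE.
by apply: section_eq => // Z EZ; exact: PG.
Qed.

Lemma proj_idem X : P (P X) = P X.
Proof. by apply/proj_section; exact: PE. Qed.

Lemma proj_linear f X Y : P (f *: X + Y) = f *: P X + P Y.
Proof.
apply: metric_app_inj => Z.
by rewrite proj_adj !metric_appDl !metric_appZl !proj_adj.
Qed.

Lemma proj_orth X : section Ep X <-> P X = 0.
Proof.
rewrite orth_sectionP; split=> [oX|PX Z EZ]; last by rewrite -PG// PX metric_app0l.
by apply: (metric_app_eq0 (g := g)); rewrite PG ?oX.
Qed.

Lemma coproj_section X : section Ep X <-> Q X = X.
Proof.
rewrite proj_orth /Q; split=> [->|/eqP]; first by rewrite subr0.
by rewrite eq_sym -subr_eq0 opprB addrC subrK => /eqP.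
Qed.

Lemma coproj_ker X : section E X <-> Q X = 0.
Proof.
rewrite proj_section /Q; split=> [->|/eqP]; first by rewrite subrr.
by rewrite subr_eq0 => /eqP.
Qed.

Lemma coproj_linear f X Y : Q (f *: X + Y) = f *: Q X + Q Y.
Proof. by rewrite /Q proj_linear scalerBr opprD addrACA. Qed.

Lemma coproj_adj X Y : G (Q X) Y = G X (Q Y).
Proof. by rewrite /Q metric_appBl metric_appBr proj_adj. Qed.

Lemma proj_coproj X : P (Q X) = 0.
Proof.
apply: metric_app_inj => Z; rewrite proj_adj metric_appBl PG ?subrr ?metric_app0l//.
Qed.

Lemma coproj_idem X : Q (Q X) = Q X.
Proof. by rewrite {1}/Q proj_coproj subr0. Qed.

(** Extend [v] to any vector field [X] and subtract [P X]. The value at [p] is unchanged: the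
    squared length of [P X] there is its pairing with [v], which is zero. *)
Lemma orth_section_through p v : Ep p v -> exists2 X, section Ep X & X p = v.
Proof.
move=> [tv ov]; have [X _ Xp] := @section_through _ _ _ _ tangent_distribution p v tv.
exists (Q X); first by apply/proj_orth; exact: proj_coproj.
have PX0 : P X p = 0.
  apply: (@mform_eq0 _ _ _ g p); first exact: vf_tangent.
  have := congr1 (fun f : smoothfun M => f p) (PG X (PE X)).
  by rewrite !metric_appE => ->; rewrite Xp; apply: ov; exact: PE.
transitivity (X p - P X p) => //.
by rewrite PX0 subr0.
Qed.

End Decomposition.

(** A zero projection means orthogonality to each fibre of [A]. Vectors of [A] extend to sections,
    so this can be tested on global fields. *)
Lemma torsion_component_zeroP {R : realType} {n : nat} {M : manifold R n}
    (g : riemannian_metric M) (nabla : vfield M -> vfield M -> vfield M)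
    (A : M -> set (smoothfun M -> R)) :
  (forall p, A p 0) ->
  (forall p v, A p v -> exists2 X : vfield M, section A X & X p = v) ->
  torsion_component_zero nabla g A A A <->
  forall X Y Z, section A X -> section A Y -> section A Z ->
    metric_app g (torsion nabla X Y) Z = 0.
Proof.
move=> A0 At; split=> [T0 X Y Z AX AY AZ|T0 X Y AX AY p].
  apply/val_inj/funext => p; have [_ []] := T0 X Y AX AY p.
  by rewrite subr0 => _ /(_ _ (AZ p)).
split=> //; rewrite subr0; split=> [|w Aw]; first exact: vf_tangent.
have [Z AZ <-] := At p w Aw.
by have := congr1 (fun f : smoothfun M => f p) (T0 X Y Z AX AY AZ).
Qed.

Lemma torsionC {R : realType} {n : nat} {M : manifold R n}
    (nabla : vfield M -> vfield M -> vfield M) (X Y : vfield M) :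
  torsion nabla X Y = - torsion nabla Y X.
Proof. by rewrite /torsion (lieC X Y) opprK !opprB addrC. Qed.

(** * The connection defined by the Koszul expressions of two complementary projections *)

Section Connection.
Context {R : realType} {n : nat} {M : manifold R n} (g : riemannian_metric M).
Implicit Types (X Y Z W V : vfield M) (f h : smoothfun M).
Variables P Q : vfield M -> vfield M.
Hypothesis P_linear : forall f X Y, P (f *: X + Y) = f *: P X + P Y.
Hypothesis P_adj : forall X Y, metric_app g (P X) Y = metric_app g X (P Y).
Hypothesis P_idem : forall X, P (P X) = P X.
Hypothesis Q_linear : forall f X Y, Q (f *: X + Y) = f *: Q X + Q Y.
Hypothesis Q_adj : forall X Y, metric_app g (Q X) Y = metric_app g X (Q Y).
Hypothesis Q_idem : forall X, Q (Q X) = Q X.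
Hypothesis PQ0 : forall X, P (Q X) = 0.
Hypothesis QP0 : forall X, Q (P X) = 0.
Hypothesis PQ_sum : forall X, P X + Q X = X.

Local Notation G := (metric_app g).

Lemma smoothfun_double_inj f h : f *+ 2 = h *+ 2 -> f = h.
Proof.
move=> E; apply/val_inj/funext => p.
have : f p + f p = h p + h p := congr1 (fun f : smoothfun M => f p) E.
by move=> E'; suff : f p = h p by []; lra.
Qed.

Lemma smoothfun_half f : exists h, h *+ 2 = f.
Proof.
exists (2^-1 *: f); apply/val_inj/funext => p.
transitivity (2^-1 * f p + 2^-1 * f p) => //.
by transitivity (f p) => //; field.
Qed.

Lemma metric_app_split Y Z : G (P Y) (P Z) + G (Q Y) (Q Z) = G Y Z.
Proof. by rewrite P_adj P_idem Q_adj Q_idem -metric_appDr PQ_sum. Qed.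

(** For fixed [X] and [Y], half the sum of the two Koszul expressions is a tensor in [Z], and Riesz
    representation on the whole tangent bundle applies. *)
Lemma exists_koszul_connection : exists nabla : vfield M -> vfield M -> vfield M,
  forall X Y Z, G (nabla X Y) Z *+ 2 = koszul g P X Y Z + koszul g Q X Y Z.
Proof.
have /choice[half halfE] := smoothfun_half.
have /choice[N NE] (XY : vfield M * vfield M) : exists V, forall Z,
    G V Z *+ 2 = koszul g P XY.1 XY.2 Z + koszul g Q XY.1 XY.2 Z.
  pose lam Z := half (koszul g P XY.1 XY.2 Z + koszul g Q XY.1 XY.2 Z).
  have [|V _ VZ] := @riesz _ _ _ g _ tangent_distribution lam.
    move=> f Z Z'; apply: smoothfun_double_inj.
    rewrite mulrnDl -mulrnAr !halfE !koszul_linear_r//; ring.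
  exists V => Z; rewrite VZ ?halfE// => q; exact: vf_tangent.
by exists (fun X Y => N (X, Y)) => X Y Z; rewrite (NE (X, Y)).
Qed.

Section KoszulConnection.
Variable nabla : vfield M -> vfield M -> vfield M.
Hypothesis nablaG : forall X Y Z,
  G (nabla X Y) Z *+ 2 = koszul g P X Y Z + koszul g Q X Y Z.

Lemma koszul_connection_metric : metric_connection nabla g.
Proof.
(* Additivity and the Leibniz rule together. The derivative terms of the two Koszul expressions add
   up to twice the derivative of [f] times [G Y Z] by [metric_app_split]. *)
have leib f X Y Y' : nabla X (f *: Y + Y') =
    vf_app X f *: Y + f *: nabla X Y + nabla X Y'.
  apply: (metric_app_inj (g := g)) => Z; apply: smoothfun_double_inj.
  rewrite !metric_appDl !metric_appZl !mulrnDl -!mulrnAr !nablaG !koszul_leibniz//.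
  by rewrite -(metric_app_split Y Z) mulrnDl; ring.
have app1 X : vf_app X 1 = 0.
  have := vf_appM X 1 1; rewrite !mul1r => /eqP.
  by rewrite -subr_eq subrr eq_sym => /eqP.
have nD X Y Z : nabla X (Y + Z) = nabla X Y + nabla X Z.
  by have := leib 1 X Y Z; rewrite app1 scale0r add0r !scale1r.
split.
  split=> // [f X Y Z|f X Y].
    apply: (metric_app_inj (g := g)) => W; apply: smoothfun_double_inj.
    rewrite metric_appDl metric_appZl mulrnDl -mulrnAr !nablaG !koszul_linear_l//.
    ring.
  have n0 : nabla X 0 = 0 by apply: morphD0; exact: nD.
  by have := leib f X Y 0; rewrite n0 !addr0.
move=> Z X Y; apply: smoothfun_double_inj; rewrite mul0rn /nabla_metric.
rewrite -addrA -opprD mulrnBl mulrnDl (metric_appC g X (nabla Z Y)) !nablaG.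
rewrite -(metric_app_split X Y) vf_appD mulrnDl -!koszul_skew; ring.
Qed.

(** Against [P Z], the expression of [P] vanishes because [P Y = 0] and that of [Q] because
    [Q (P Z) = 0]. *)
Lemma koszul_connection_ker X Y : P Y = 0 -> P (nabla X Y) = 0.
Proof.
move=> PY; apply: (metric_app_inj (g := g)) => Z; apply: smoothfun_double_inj.
rewrite P_adj nablaG koszul_eq0l// koszul_eq0r ?QP0//.
by rewrite metric_app0l mul0rn addr0.
Qed.

Let Q0 X : P X = X -> Q X = 0.
Proof. by move=> <-. Qed.

Let nablaP X Y Z : P Z = Z -> G (nabla X Y) Z *+ 2 = koszul g P X Y Z.
Proof. by move=> /Q0 QZ; rewrite nablaG (koszul_eq0r _ _ _ QZ) addr0. Qed.

Lemma koszul_connection_torsion X Y Z : P X = X -> P Y = Y -> P Z = Z ->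
  G (torsion nabla X Y) Z = 0.
Proof.
move=> PX PY PZ; apply: smoothfun_double_inj.
rewrite /torsion 2!metric_appBl 2!mulrnBl (nablaP X Y PZ) (nablaP Y X PZ).
rewrite (koszul_torsion g PX PY PZ).
by rewrite subrr mul0rn.
Qed.

Lemma koszul_connection_symmetric X Y Z : P X = X -> P Y = Y -> P Z = 0 ->
  G (torsion nabla Z X) Y = G X (torsion nabla Z Y).
Proof.
move=> PX PY PZ; apply: smoothfun_double_inj.
have z A B : P B = B -> G (nabla A Z) B = 0.
  by move=> PB; rewrite -PB -P_adj koszul_connection_ker// metric_app0l.
rewrite (metric_appC g X) /torsion 4!metric_appBl (z X Y PY) (z Y X PX) 2!subr0.
rewrite 2!mulrnBl (nablaP Z X PY) (nablaP Z Y PX).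
exact: koszul_symmetric.
Qed.

End KoszulConnection.
End Connection.

(** * Existence and uniqueness of the adapted metric connection *)

Theorem theorem3 (R : realType) (n : nat) (M : manifold R n)
    (S : sub_riemannian M) (g : riemannian_metric M)
    (gh : restricts_to g (sr_metric S)) :
  let D := dfib (sr_dist S) in
  let Dp := orth g D in
  exists! nabla : vfield M -> vfield M -> vfield M,
    metric_connection nabla g /\
    preserves nabla D /\ preserves nabla Dp /\
    let T := torsion nabla in
    [/\ torsion_component_zero nabla g D D D,
        torsion_component_zero nabla g Dp Dp Dp,
        forall Z X Y : vfield M, section D Z -> section Dp X -> section Dp Y ->
          metric_app g (T Z X) Y = metric_app g X (T Z Y) &
        forall X Y Z : vfield M, section D X -> section D Y -> section Dp Z ->
          metric_app g (T X Z) Y = metric_app g X (T Y Z)].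
Proof.
move=> D Dp.
have [P [PE PG]] := exists_orth_proj g (sr_dist S).
pose Q X := X - P X.
have PL := proj_linear PE PG; have PA := proj_adj PE PG; have PI := proj_idem PE PG.
have QL : forall f X Y, Q (f *: X + Y) = f *: Q X + Q Y := coproj_linear PE PG.
have QA : forall X Y, metric_app g (Q X) Y = metric_app g X (Q Y) := coproj_adj PE PG.
have QI : forall X, Q (Q X) = Q X := coproj_idem PE PG.
have PQ0 : forall X, P (Q X) = 0 := proj_coproj PE PG.
have QP0 X : Q (P X) = 0 by rewrite /Q PI subrr.
have PQ X : P X + Q X = X by rewrite /Q addrC subrK.
have DP X : section D X <-> P X = X := proj_section PE PG X.
have DQ X : section D X <-> Q X = 0 := coproj_ker PE PG X.
have DpQ X : section Dp X <-> Q X = X := coproj_section PE PG X.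
have DpP X : section Dp X <-> P X = 0 := proj_orth PE PG X.
(* From here on [Q] is known only through the facts above, and [P] and [Q] can exchange roles. *)
clearbody Q.
have D0 p : D p 0 by exact: dfib0.
have Dp0 p : Dp p 0.
  split=> [|w Dw]; first exact: dfib_tangent (D0 p).
  have [Z DZ <-] := section_through Dw.
  have := metric_app0l g Z; move=> /(congr1 (fun f : smoothfun M => f p)); exact.
have TD nabla := torsion_component_zeroP g nabla D0
  (fun p v => @section_through _ _ _ _ _ p v).
have TDp nabla := torsion_component_zeroP g nabla Dp0
  (fun p v => @orth_section_through _ _ _ _ _ _ _ PE PG p v).
have [N NG] := exists_koszul_connection g PL QL.
(* The same formula with [P] and [Q] exchanged: each property of [N] proved for the image of [P]
   then holds for that of [Q]. *)
have NG' X Y Z : metric_app g (N X Y) Z *+ 2 = koszul g Q X Y Z + koszul g P X Y Z.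
  by rewrite NG addrC.
exists N; split.
  split; first by apply: (koszul_connection_metric (P := P) (Q := Q)).
  split; first by move=> X Y /DQ QY; apply/DQ; exact: (koszul_connection_ker QA PQ0 NG').
  split; first by move=> X Y /DpP PY; apply/DpP; exact: (koszul_connection_ker PA QP0 NG).
  split.
  - apply/TD => X Y Z /DP PX /DP PY /DP PZ.
    exact: (koszul_connection_torsion QP0 NG).
  - apply/TDp => X Y Z /DpQ QX /DpQ QY /DpQ QZ.
    exact: (koszul_connection_torsion PQ0 NG').
  - move=> Z X Y /DQ QZ /DpQ QX /DpQ QY.
    exact: (koszul_connection_symmetric QA PQ0 NG').
  - move=> X Y Z /DP PX /DP PY /DpP PZ.
    rewrite (torsionC _ X) (torsionC _ Y) metric_appNl metric_appNr; congr (- _).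
    exact: (koszul_connection_symmetric PA QP0 NG).
move=> N' [[N'lin N'met] [N'D [N'Dp [TN'D TN'Dp symDp symD]]]].
have N'kerP X Y : P Y = 0 -> P (N' X Y) = 0 by move=> /DpP DY; apply/DpP; exact: N'Dp.
have N'kerQ X Y : Q Y = 0 -> Q (N' X Y) = 0 by move=> /DQ DY; apply/DQ; exact: N'D.
have UP X Y Z : P Y = Y -> P Z = Z ->
    metric_app g (N' X Y) Z *+ 2 = koszul g P X Y Z.
  apply: koszul_unique => //.
    by move=> {}X {}Y {}Z /DP ? /DP ? /DP ?; exact: (TD N').1.
  move=> {}X {}Y {}Z /DP ? /DP ? /DpP ?.
  rewrite (torsionC _ Z X) (torsionC _ Z Y) metric_appNl metric_appNr; congr (- _).
  exact: symD.
have UQ X Y Z : Q Y = Y -> Q Z = Z ->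
    metric_app g (N' X Y) Z *+ 2 = koszul g Q X Y Z.
  apply: koszul_unique => //.
    by move=> {}X {}Y {}Z /DpQ ? /DpQ ? /DpQ ?; exact: (TDp N').1.
  by move=> {}X {}Y {}Z /DpQ ? /DpQ ? /DQ ?; exact: symDp.
apply/funext => X; apply/funext => Y; apply: (metric_app_inj (g := g)) => Z.
apply: smoothfun_double_inj; rewrite NG.
have [_ N'add _] := N'lin.
have PN : P (N' X (P Y)) = N' X (P Y) by apply/DP/N'D/DP.
have QN : Q (N' X (Q Y)) = N' X (Q Y) by apply/DpQ/N'Dp/DpQ.
(* As [N'] preserves both subbundles, the mixed pairings vanish. The two diagonal ones are given by
   [UP] and [UQ], so [N'] satisfies the formula that defines [N]. *)
have -> : metric_app g (N' X Y) Z =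
    metric_app g (N' X (P Y)) (P Z) + metric_app g (N' X (Q Y)) (Q Z).
  transitivity (metric_app g (N' X (P Y + Q Y)) (P Z + Q Z)); first by rewrite !PQ.
  have cPQ : metric_app g (N' X (P Y)) (Q Z) = 0.
    by rewrite -PN PA PQ0 metric_app0r.
  have cQP : metric_app g (N' X (Q Y)) (P Z) = 0.
    by rewrite -QN QA QP0 metric_app0r.
  by rewrite N'add metric_appDl !metric_appDr cPQ cQP addr0 add0r.
by rewrite mulrnDl UP// UQ// !koszul_proj.
Qed.
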